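(* Let $v=(v_j)_{j\in\mathbb{Z}}$ be a real sequence with finite support and let $z\in\mathbb{C}^+=\{\Im z>0\}$. Then $$ \det\left[\frac{H-z}{H_0-z}\right]=\prod_{j=-\infty}^{\infty}\frac{\tilde\lambda(z)}{\lambda_j(z)}\cdot \exp\Bigl(\tfrac12\,\mathrm{tr}\bigl[\Omega L(L-\Lambda)^{-1}(R-\Lambda)^{-1}(R\Omega+\Omega L)(R-\Lambda)^{-1}(L-\Lambda)^{-1}\bigr]\Bigr) $$ $$ \times\Bigl[\det{}_2\bigl[I+\Omega L(R-\Lambda)^{-1}(L-\Lambda)^{-1}\bigr]\;\det{}_2\bigl[I-\Omega L(L-\Lambda)^{-1}(R-\Lambda)^{-1}\bigr]\Bigr]^{1/2}, $$ for a suitable choice of the square root in the last factor.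
   Context: On $\ell^2(\mathbb{Z})$, $(Rf)_n=f_{n-1}$ and $(Lf)_n=f_{n+1}$ are the shifts, $L=R^*=R^{-1}$. $H_0=L+R$, and $H=H_0+v$ is the discrete Schrödinger operator with potential $v$: $(Hf)_n=f_{n+1}+f_{n-1}+v_nf_n$. By definition $\det[(H-z)/(H_0-z)]=\det[I+(H_0-z)^{-1}(H-H_0)]$ (Fredholm determinant). For $z\in\mathbb{C}^+$, $$\lambda_n(z)=\frac{z-v_n-[(z-v_n)^2-4]^{1/2}}{2},\qquad \tilde\lambda(z)=\frac{z-[z^2-4]^{1/2}}{2},$$ where in these two formulas the square root has its cut along the positive axis and takes values in the upper half-plane, so that $\lambda_n(z),\tilde\lambda(z)$ lie in the lower half of the open unit disc. $\Lambda=\Lambda(z)$ is the diagonal operator with entries $\lambda_n(z)$, and $\Omega=\Omega(z)$ is the diagonal operator with entries $\omega_n=\lambda_{n+1}(z)-\lambda_n(z)$, $n\in\mathbb{Z}$. $L-\Lambda$ and $R-\Lambda$ are boundedly invertible. For a Hilbert–Schmidt operator $A$, $\det_2(I+A)=\det\bigl((I+A)e^{-A}\bigr)$ is the regularized determinant. *)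

(* Defs.v *)
From mathcomp Require Import all_boot all_order all_algebra finmap.
From mathcomp Require Import complex.
From mathcomp Require Import all_classical all_reals all_analysis.
From mathcomp Require summability.
Import Order.TTheory GRing.Theory Num.Theory.
Import numFieldNormedType.Exports.

Set Implicit Arguments.
Unset Strict Implicit.
Unset Printing Implicit Defensive.

Local Open Scope classical_set_scope.
Local Open Scope ring_scope.
Local Open Scope complex_scope.

(* Operators on l^2(Z) are written as maps on all complex sequences indexed by
   Z, with the pointwise module structure.  Every operator occurring in the
   theorem maps l^2(Z) to itself, and only its values on l^2(Z) matter. *)
Notation seqZ R := (int -> R[i]).
Notation opZ R := (seqZ R -> seqZ R).

Section Defs.
Variable R : realType.
(* The cast selects the topology of a numFieldType on R[i]. *)
Local Notation C := (R[i] : numFieldType).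
Implicit Types (A B T : opZ R) (f g : seqZ R) (a : int -> R[i]).
Implicit Types (v : int -> R) (z : R[i]).

Definition ell2 f : Prop :=
  (\esum_(n in [set: int]) ((complex.Re `|f n|) ^+ 2)%:E < +oo)%E.

Definition delta (k : int) : seqZ R := fun n => (n == k)%:R.

Definition shiftR : opZ R := fun f n => f (n - 1).
Definition shiftL : opZ R := fun f n => f (n + 1).
Definition diag a : opZ R := fun f n => a n * f n.

(* opinv A g is the solution f in l^2(Z) of A f = g.  When A is boundedly
   invertible on l^2(Z) this solution exists and is unique for g in l^2(Z), and
   opinv A is the bounded inverse of A; the value 0 is returned when there is
   no solution in l^2(Z). *)
Definition opinv A : opZ R :=
  fun g => xget 0 [set f | ell2 f /\ A f = g].

(* Unconditional sum: limit along the finite subsets of I ordered by inclusion. *)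
Definition usum (I : choiceType) (x : I -> R[i]) : R[i] :=
  summability.sum (x : I -> C).

Definition cexp z : R[i] :=
  (expR (complex.Re z))%:C *
  (cos (complex.Im z) +i* sin (complex.Im z)).

(* The matrix element <delta_m, A delta_n>. *)
Definition mx_elt A (m n : int) : R[i] := A (delta n) m.

Definition optrace A : R[i] := usum (fun n : int => mx_elt A n n).

(* The trace of the k-th exterior power of A, computed in the orthonormal basis
   delta_(s_1) /\ ... /\ delta_(s_k) of the k-th exterior power of l^2(Z), which
   is indexed by the k-element subsets S of Z: the diagonal matrix element at S
   is the principal minor of A with rows and columns in S. *)
Definition principal_minor A (S : {fset int}) : R[i] :=
  \det (\matrix_(i < #|{: S}|, j < #|{: S}|)
          mx_elt A (val (enum_val i)) (val (enum_val j))).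

Definition ext_trace A (k : nat) : R[i] :=
  usum (fun S : {fset int} =>
          if #|` S| == k then principal_minor A S else 0).

(* The Fredholm determinant det(I + A) = \sum_k tr(/\^k A) of T = I + A, for A
   of trace class. *)
Definition fredholm_det T : R[i] :=
  limn (series (ext_trace (T - id) : nat -> C)).

(* e^A, whose power series converges in norm, hence entrywise, for bounded A. *)
Definition opexp A : opZ R :=
  fun f n => limn (series ((fun k => (k`!)%:R^-1 * iter k A f n) : nat -> C)).

(* det_2(I + A) = det((I + A) e^(-A)) as a function of T = I + A, for A of
   Hilbert-Schmidt class. *)
Definition det2 T : R[i] := fredholm_det (T \o opexp (id - T)).

Definition H0 : opZ R := shiftL + shiftR.
Definition H v : opZ R := H0 + diag (fun n => (v n)%:C).

(* sqrtC is the square root with argument in [0, pi[: its cut is the positive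
   axis and its values lie in the closed upper half-plane. *)
Definition joukowski z : R[i] := (z - sqrtC (z ^+ 2 - 4)) / 2.

Definition lambda v z (n : int) : R[i] := joukowski (z - (v n)%:C).
Definition lambda_tilde z : R[i] := joukowski z.
Definition omega v z (n : int) : R[i] := lambda v z (n + 1) - lambda v z n.

Definition Lambda v z : opZ R := diag (lambda v z).
Definition Omega v z : opZ R := diag (omega v z).

End Defs.

Arguments shiftR {R}.
Arguments shiftL {R}.
Arguments H0 {R}.

(* Main.v *)
Require Import Defs.
From mathcomp Require Import all_boot all_order all_algebra finmap perm.
From mathcomp Require Import complex.
From mathcomp Require Import all_classical all_reals all_analysis.
From mathcomp Require Import mxred spectral ring zify.
From mathcomp Require summability.
Import Order.TTheory GRing.Theory Num.Theory.
Import numFieldNormedType.Exports.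

(** Where [v] vanishes, [lambda] equals [q = lambda_tilde z]; so [Omega] and
    [V = H - H_0] have finite rank, and every determinant becomes one of an
    [N x N] matrix indexed by a window [b, ..., b + N - 1] containing the support
    of [v].  On functions that continue geometrically (ratio [q]) outside of the
    window, a tridiagonal operator acts through its compression, with the corner
    entries diminished by [q^2].  For these corrected matrices
      [(L - Lambda)(R - Lambda)] and [(R - Lambda)(L - Lambda)] both have
    determinant [1 - q^2] by an LDL^T factorization, their inverses [X], [Y] give
    [(R - Lambda)^-1 (L - Lambda)^-1] and [(L - Lambda)^-1 (R - Lambda)^-1], and
      [-Lambda (H - z) = (L - Lambda)(R - Lambda) + Omega L],
      [-(H - z) Lambda = (R - Lambda)(L - Lambda) - Omega L]
    are transposes of each other.  Hence, for [A1 = Omega L (R - Lambda)^-1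
    (L - Lambda)^-1] and [A2 = Omega L (L - Lambda)^-1 (R - Lambda)^-1],
    [det (1 + A1) = det (1 - A2)], and the perturbation determinant is the product
    of the [q / lambda_j] times this common value.  Finally the operator whose
    trace is exponentiated has the same diagonal as [A1 - A2], because
    [(R - Lambda)(L - Lambda) - (L - Lambda)(R - Lambda) = R Omega + Omega L], and
    [det_2 (1 + A) = det (1 + A) e^(- tr A)] in finite rank. *)

Set Implicit Arguments.
Unset Strict Implicit.
Unset Printing Implicit Defensive.

Local Open Scope classical_set_scope.
Local Open Scope ring_scope.
Local Open Scope complex_scope.

(** * Sums of principal minors *)

(** The same permutation acts on the rows and on the columns, so its sign enters squared. *)
Lemma det_mxsub_bij (K : comNzRingType) m n (f : 'I_m -> 'I_n) (A : 'M[K]_n) :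
  bijective f -> \det (mxsub f f A) = \det A.
Proof.
move=> bf; have mn : m = n by rewrite -[m]card_ord -[n]card_ord; exact: bij_eq_card bf.
case: _ / mn A f bf => A f bf.
have finj := bij_inj bf; pose s := perm finj.
have -> : mxsub f f A = row_perm s (col_perm s A).
  by apply/matrixP => i j; rewrite !mxE !permE.
rewrite row_permE col_permE !det_mulmx !det_perm odd_permV mulrA mulrAC.
by rewrite -signr_addb addbb mul1r.
Qed.

(* Listing the indices of [S] first turns the matrix into a block one. *)
Lemma det_partial_rows (K : comNzRingType) n k (A : 'M[K]_n) (S : {set 'I_n})
    (f : 'I_k -> 'I_n) :
  injective f -> (forall i, (i \in S) = (i \in codom f)) ->
  \det (\matrix_(i, j) (if i \in S then A i j else (i == j)%:R)) =
  \det (mxsub f f A).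
Proof.
move=> finj fS; set B := \matrix_(i, j) _.
pose g (u : 'I_(k + #|~: S|)) : 'I_n :=
  match fintype.split u with inl i => f i | inr i => enum_val i end.
have gS u : g u \in S = (u < k)%N.
  rewrite /g; case: splitP => i _; first by rewrite fS codom_f.
  by apply/negbTE; have := enum_valP i; rewrite inE.
have ginj : injective g.
  move=> u w; move: (gS u) (gS w); rewrite /g.
  case: splitP => i ui; case: splitP => j wj h1 h2 e.
  - by apply: val_inj; rewrite /= ui wj (finj _ _ e).
  - by move: h1; rewrite e h2.
  - by move: h1; rewrite e h2.
  - by apply: val_inj; rewrite /= ui wj (enum_val_inj e).
have cS : #|S| = k.
  rewrite -[k in RHS]card_ord -(card_codom finj).
  by apply: eq_card => i; rewrite fS.
have gbij : bijective g.
  by apply: inj_card_bij => //; rewrite !card_ord -{1}cS cardsC card_ord.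
rewrite -(det_mxsub_bij _ gbij) -[mxsub g g B]submxK.
(* Rows with index outside of [S] are rows of the identity, so the lower blocks are [0] and [1]. *)
have -> : dlsubmx (mxsub g g B) = 0.
  apply/matrixP => i j; rewrite !mxE gS /= ltnNge leq_addr /=.
  case: eqVneq => // /ginj /(congr1 val) /= h.
  by have := ltn_ord j; rewrite -h ltnNge leq_addr.
have -> : drsubmx (mxsub g g B) = 1%:M.
  apply/matrixP => i j; rewrite !mxE gS /= ltnNge leq_addr /=.
  by rewrite (inj_eq ginj) -val_eqE /= eqn_add2l.
rewrite det_ublock det1 mulr1; congr (\det _).
have gl i : g (lshift #|~: S| i) = f i.
  rewrite /g; case: splitP => j /= ij; first by congr f; apply: val_inj.
  by have := ltn_ord i; rewrite ij ltnNge leq_addr.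
by apply/matrixP => i j; rewrite !mxE gS /= ltn_ord !gl.
Qed.

(** Expand the product over the rows in each Leibniz term: [S] collects the rows where the entry of
    [A] is taken instead of that of the identity. *)
Lemma det_add1mx (K : comNzRingType) n (A : 'M[K]_n) :
  \det (1%:M + A) = \sum_(S : {set 'I_n})
    \det (\matrix_(i, j) (if i \in S then A i j else (i == j)%:R)).
Proof.
rewrite [RHS](exchange_big _ _ _ _ _ (fun (S : {set 'I_n}) (s : 'S_n) => _)) /=.
apply: eq_bigr => s _; rewrite -mulr_sumr; congr (_ * _).
under eq_bigr do rewrite !mxE addrC.
rewrite bigA_distr; apply: eq_bigr => S _.
by apply: eq_bigr => i _; rewrite mxE.
Qed.

(** * The complex exponential *)

Section ComplexExp.
Variable R : realType.
Local Notation C := (R[i] : numFieldType).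
Implicit Types (z : R[i]).

Lemma normc_ReIm_le (a b : R) : `|a +i* b| <= (`|a| + `|b|)%:C.
Proof.
rewrite (_ : a +i* b = a%:C + 0 +i* b); last first.
  by apply/eqP; rewrite eq_complex /= addr0 add0r !eqxx.
rewrite (le_trans (ler_normD _ _))// rmorphD /= lerD //.
  by rewrite normc_def /= expr0n addr0 sqrtr_sqr.
by rewrite normc_def /= expr0n add0r sqrtr_sqr.
Qed.

Lemma normc_ge_Im z : `|complex.Im z|%:C <= `|z|.
Proof. by rewrite normc_def lecR -sqrtr_sqr ler_wsqrtr // lerDr sqr_ge0. Qed.

Lemma cvg_complex (u w : nat -> R) (a b : R) :
  u @ \oo --> a -> w @ \oo --> b ->
  ((fun n => u n +i* w n) : nat -> C) @ \oo --> (a +i* b : C).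
Proof.
move=> /cvgrPdist_lt ua /cvgrPdist_lt wb; apply/cvgrPdist_lt => e.
(* In the order of [R[i]], positivity of [e] forces its imaginary part to vanish. *)
case: e => e1 e2; rewrite ltcE /= => /andP[/eqP -> e0].
have e20 : 0 < e1 / 2 by rewrite divr_gt0.
near=> n.
have -> : (a +i* b) - (u n +i* w n) = (a - u n) +i* (b - w n) :> C by [].
apply: le_lt_trans (normc_ReIm_le _ _) _; rewrite ltcR (splitr e1) ltrD //.
  by near: n; exact: ua.
by near: n; exact: wb.
Unshelve. all: by end_near. Qed.

Lemma is_cvg_series_fact (u : nat -> R) (K : R) :
  (forall k, `|u k| <= K ^+ k) -> cvgn (series (fun k => (k`!)%:R^-1 * u k)).
Proof.
move=> uK; apply: normed_cvg.
apply: series_le_cvg (is_cvg_series_exp_coeff K).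
- by move=> n; exact: normr_ge0.
- by move=> n; rewrite /exp_coeff /= divr_ge0 // (le_trans _ (uK n)).
move=> n; rewrite /exp_coeff /= normrM (ger0_norm (x := _^-1)) ?invr_ge0 ?ler0n //.
by rewrite mulrC ler_wpM2r // invr_ge0 ler0n.
Qed.

Lemma series_complex (u : nat -> R[i]) :
  series (u : nat -> C) =
  (fun n => series (fun k => complex.Re (u k)) n +i*
            series (fun k => complex.Im (u k)) n).
Proof.
apply/funext => n; rewrite /series /=; elim: n => [|n IHn]; first by rewrite !big_geq.
by rewrite !big_nat_recr //= IHn; case: (u n).
Qed.

Lemma Re_invfact k z : complex.Re ((k`!)%:R^-1 * z) = (k`!)%:R^-1 * complex.Re z.
Proof.
have -> : ((k`!)%:R^-1 : R[i]) = ((k`!)%:R^-1 : R)%:C by rewrite fmorphV rmorph_nat.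
by case: z => a b /=; rewrite mul0r subr0.
Qed.

Lemma Im_invfact k z : complex.Im ((k`!)%:R^-1 * z) = (k`!)%:R^-1 * complex.Im z.
Proof.
have -> : ((k`!)%:R^-1 : R[i]) = ((k`!)%:R^-1 : R)%:C by rewrite fmorphV rmorph_nat.
by case: z => a b /=; rewrite mul0r addr0.
Qed.

Lemma is_cvg_cseries_fact (u : nat -> R[i]) (K : R) :
  (forall k, `|u k| <= (K ^+ k)%:C) ->
  cvgn (series ((fun k => (k`!)%:R^-1 * u k) : nat -> C)).
Proof.
move=> uK; rewrite series_complex.
under eq_fun do rewrite (funext (fun k => Re_invfact k (u k)))
  (funext (fun k => Im_invfact k (u k))).
apply/cvg_ex; eexists; apply: cvg_complex; apply: is_cvg_series_fact (K) _ => k.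
  by rewrite -lecR (le_trans (normc_ge_Re _)).
by rewrite -lecR (le_trans (normc_ge_Im _)).
Qed.

(** [re_coef] and [im_coef] are the Taylor coefficients in the real variable [t] of the real and
    imaginary parts of [e^(tz)], so that the theory of real power series applies. *)
Definition re_coef z k : R := (k`!)%:R^-1 * complex.Re (z ^+ k).
Definition im_coef z k : R := (k`!)%:R^-1 * complex.Im (z ^+ k).

Lemma is_cvg_re_coef z t : cvgn (pseries (re_coef z) t).
Proof.
rewrite (_ : pseries _ t = series (fun k => (k`!)%:R^-1 * (complex.Re (z ^+ k) * t ^+ k))).
  apply: (@is_cvg_series_fact _ (complex.Re `|z| * `|t|)) => k.
  rewrite normrM normrX exprMn ler_wpM2r ?exprn_ge0 // -lecR.
  by rewrite (le_trans (normc_ge_Re _))// normrX [in leRHS]normc_def /= rmorphXn normc_def lexx.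
by rewrite /pseries; congr (series _); apply/funext => k; rewrite mulrA.
Qed.

Lemma is_cvg_im_coef z t : cvgn (pseries (im_coef z) t).
Proof.
rewrite (_ : pseries _ t = series (fun k => (k`!)%:R^-1 * (complex.Im (z ^+ k) * t ^+ k))).
  apply: (@is_cvg_series_fact _ (complex.Re `|z| * `|t|)) => k.
  rewrite normrM normrX exprMn ler_wpM2r ?exprn_ge0 // -lecR.
  by rewrite (le_trans (normc_ge_Im _))// normrX [in leRHS]normc_def /= rmorphXn normc_def lexx.
by rewrite /pseries; congr (series _); apply/funext => k; rewrite mulrA.
Qed.

(** Real part of [(e^(tz))' = z e^(tz)], read on coefficients; [diffs_im_coef] is the imaginary
    part. *)
Lemma diffs_re_coef (a b : R) : pseries_diffs (re_coef (a +i* b)) =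
  a *: re_coef (a +i* b) - b *: im_coef (a +i* b).
Proof.
apply/funext => k; rewrite /pseries_diffs /re_coef factS natrM invfM.
rewrite -mulrA mulVKf ?pnatr_eq0 // exprS.
rewrite -[RHS]/(a * (_ * complex.Re _) - b * (_ * complex.Im _)).
by case: (_ ^+ k) => c d /=; ring.
Qed.

Lemma diffs_im_coef (a b : R) : pseries_diffs (im_coef (a +i* b)) =
  a *: im_coef (a +i* b) + b *: re_coef (a +i* b).
Proof.
apply/funext => k; rewrite /pseries_diffs /im_coef factS natrM invfM.
rewrite -mulrA mulVKf ?pnatr_eq0 // exprS.
rewrite -[RHS]/(a * (_ * complex.Im _) + b * (_ * complex.Re _)).
by case: (_ ^+ k) => c d /=; ring.
Qed.

Lemma cvg_pseriesZ (a : R) (f : nat -> R) t :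
  cvgn (pseries f t) -> pseries (a *: f) t @ \oo --> a * limn (pseries f t).
Proof.
move=> cf; rewrite (_ : pseries (a *: f) t = a *: pseries f t).
  exact: cvgZr cf.
by apply/funext => n; rewrite /pseries /series /= -[RHS]/(a * _) mulr_sumr;
  apply: eq_bigr => i _; rewrite mulrA.
Qed.

Lemma cvg_pseries_lin (a b : R) (f g : nat -> R) t :
  cvgn (pseries f t) -> cvgn (pseries g t) ->
  pseries (a *: f + b *: g) t @ \oo -->
    a * limn (pseries f t) + b * limn (pseries g t).
Proof.
move=> cf cg; rewrite (_ : pseries _ t = pseries (a *: f) t + pseries (b *: g) t).
  by apply: cvgD; apply: cvg_pseriesZ.
apply/funext => n; rewrite /pseries /series /= -[RHS]/(_ + _) -big_split /=.
by apply: eq_bigr => i _; rewrite -mulrDl.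
Qed.

Lemma is_derive_re_series (a b t : R) : is_derive t (1 : R)
  (fun t => limn (pseries (re_coef (a +i* b)) t))
  (a * limn (pseries (re_coef (a +i* b)) t) - b * limn (pseries (im_coef (a +i* b)) t)).
Proof.
have lin c d u : pseries (c *: re_coef (a +i* b) + d *: im_coef (a +i* b)) u @ \oo -->
    c * limn (pseries (re_coef (a +i* b)) u) + d * limn (pseries (im_coef (a +i* b)) u).
  by apply: cvg_pseries_lin; [exact: is_cvg_re_coef|exact: is_cvg_im_coef].
rewrite -mulNr -(cvg_lim _ (lin a (- b) t)) //.
have -> : a *: re_coef (a +i* b) + - b *: im_coef (a +i* b) =
    pseries_diffs (re_coef (a +i* b)) by rewrite diffs_re_coef scaleNr.
(* Termwise differentiation at [t] asks for convergence of the series and of its first two derived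
   series at a point beyond [|t|]; here [|t| + 1]. *)
apply: (@pseries_snd_diffs _ _ (`|t| + 1)); first exact: is_cvg_re_coef.
- by rewrite diffs_re_coef -scaleNr; apply/cvg_ex; eexists; exact: lin.
(* The coefficients are the real and imaginary parts of [(a + ib)^2], up to sign. *)
- rewrite (_ : pseries_diffs (pseries_diffs _) =
      (a ^+ 2 - b ^+ 2) *: re_coef (a +i* b) + (- 2 * a * b) *: im_coef (a +i* b)).
    by apply/cvg_ex; eexists; exact: lin.
  rewrite diffs_re_coef; apply/funext => k.
  transitivity (a * pseries_diffs (re_coef (a +i* b)) k -
                b * pseries_diffs (im_coef (a +i* b)) k).
    rewrite /pseries_diffs.
    rewrite -[(a *: _ - b *: _) k.+1]/(a * re_coef _ _ - b * im_coef _ _); ring.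
  rewrite diffs_re_coef diffs_im_coef.
  rewrite -[(a *: _ - _) k]/(a * re_coef _ _ - b * im_coef _ _).
  rewrite -[(a *: _ + _) k]/(a * im_coef _ _ + b * re_coef _ _).
  rewrite -[RHS]/((a ^+ 2 - b ^+ 2) * re_coef _ _ + (- 2 * a * b) * im_coef _ _); ring.
by rewrite [ltRHS]ger0_norm ?addr_ge0 // ltrDl.
Qed.

Lemma is_derive_im_series (a b t : R) : is_derive t (1 : R)
  (fun t => limn (pseries (im_coef (a +i* b)) t))
  (a * limn (pseries (im_coef (a +i* b)) t) + b * limn (pseries (re_coef (a +i* b)) t)).
Proof.
have lin c d u : pseries (c *: im_coef (a +i* b) + d *: re_coef (a +i* b)) u @ \oo -->
    c * limn (pseries (im_coef (a +i* b)) u) + d * limn (pseries (re_coef (a +i* b)) u).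
  by apply: cvg_pseries_lin; [exact: is_cvg_im_coef|exact: is_cvg_re_coef].
rewrite -(cvg_lim _ (lin a b t)) // -diffs_im_coef.
apply: (@pseries_snd_diffs _ _ (`|t| + 1)); first exact: is_cvg_im_coef.
- by rewrite diffs_im_coef; apply/cvg_ex; eexists; exact: lin.
- rewrite (_ : pseries_diffs (pseries_diffs _) =
      (a ^+ 2 - b ^+ 2) *: im_coef (a +i* b) + (2 * a * b) *: re_coef (a +i* b)).
    by apply/cvg_ex; eexists; exact: lin.
  rewrite diffs_im_coef; apply/funext => k.
  transitivity (a * pseries_diffs (im_coef (a +i* b)) k +
                b * pseries_diffs (re_coef (a +i* b)) k).
    rewrite /pseries_diffs.
    rewrite -[(a *: _ + b *: _) k.+1]/(a * im_coef _ _ + b * re_coef _ _); ring.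
  rewrite diffs_re_coef diffs_im_coef.
  rewrite -[(a *: _ - _) k]/(a * re_coef _ _ - b * im_coef _ _).
  rewrite -[(a *: _ + _) k]/(a * im_coef _ _ + b * re_coef _ _).
  rewrite -[RHS]/((a ^+ 2 - b ^+ 2) * im_coef _ _ + (2 * a * b) * re_coef _ _); ring.
by rewrite [ltRHS]ger0_norm ?addr_ge0 // ltrDl.
Qed.

(* Both [e^(-ta) (p cos (tb) + q sin (tb))] and [e^(-ta) (q cos (tb) - p sin (tb))]
   have zero derivative, where [p + iq] is the power series of [e^(t(a+ib))]. *)
Lemma lim_re_im_series (a b t : R) :
  limn (pseries (re_coef (a +i* b)) t) = expR (a * t) * cos (b * t) /\
  limn (pseries (im_coef (a +i* b)) t) = expR (a * t) * sin (b * t).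
Proof.
set p := fun t => limn (pseries (re_coef (a +i* b)) t).
set q := fun t => limn (pseries (im_coef (a +i* b)) t).
have dp u : is_derive u (1 : R) p (a * p u - b * q u) by exact: is_derive_re_series.
have dq u : is_derive u (1 : R) q (a * q u + b * p u) by exact: is_derive_im_series.
have dlin (c u : R) : is_derive u (1 : R) (fun t => c * t) c.
  by apply: is_derive_eq; rewrite /GRing.scale /= mulr1.
have dE u : is_derive u (1 : R) (fun t => expR (- a * t)) (- a * expR (- a * u)).
  have := is_derive1_comp (is_derive_expR (- a * u)) (dlin (- a) u).
  by rewrite mulrC.
have dc u : is_derive u (1 : R) (fun t => cos (b * t)) (- b * sin (b * u)).
  have := is_derive1_comp (is_derive_cos (b * u)) (dlin b u).
  by rewrite mulNr mulrC -mulNr.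
have ds u : is_derive u (1 : R) (fun t => sin (b * t)) (b * cos (b * u)).
  have := is_derive1_comp (is_derive_sin (b * u)) (dlin b u).
  by rewrite mulrC.
pose h1 t := expR (- a * t) * (p t * cos (b * t) + q t * sin (b * t)).
pose h2 t := expR (- a * t) * (q t * cos (b * t) - p t * sin (b * t)).
have h1t : h1 t = h1 0.
  apply: is_derive_0_is_cst => u; rewrite /h1.
  have D := is_deriveM (dE u) (is_deriveD (is_deriveM (dp u) (dc u)) (is_deriveM (dq u) (ds u))).
  apply: (is_derive_eq D); rewrite /GRing.scale /= !fctE; ring.
have h2t : h2 t = h2 0.
  apply: is_derive_0_is_cst => u; rewrite /h2.
  have D := is_deriveM (dE u) (is_deriveB (is_deriveM (dq u) (dc u)) (is_deriveM (dp u) (ds u))).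
  apply: (is_derive_eq D); rewrite /GRing.scale /= !fctE; ring.
have series0 (f : nat -> R) : limn (pseries f 0) = f 0%N.
  apply: cvg_lim => //; apply: cvg_near_cst; near=> n; rewrite /pseries /series /=.
  have n0 : (0 < n)%N by near: n; exists 1%N.
  rewrite big_ltn // expr0 mulr1 big_nat big1 ?addr0 // => i /andP[i0 _].
  by rewrite expr0n gtn_eqF // mulr0.
have p0 : p 0 = 1 by rewrite /p series0 /re_coef fact0 invr1 mul1r.
have q0 : q 0 = 0 by rewrite /q series0 /im_coef fact0 invr1 mul1r.
move: h1t h2t; rewrite /h1 /h2 p0 q0 !mulr0 expR0 cos0 sin0.
rewrite !mulr0 !mul0r !mul1r addr0 subr0 mulNr expRN => e1 e2.
have E0 : expR (a * t) != 0 by rewrite gt_eqF ?expR_gt0.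
have {}e1 : p t * cos (b * t) + q t * sin (b * t) = expR (a * t).
  by rewrite -[RHS]mulr1 -e1 mulrA divff // mul1r.
have {}e2 : q t * cos (b * t) - p t * sin (b * t) = 0.
  by apply/eqP; move/eqP: e2; rewrite mulf_eq0 invr_eq0 (negbTE E0).
have cs := cos2Dsin2 (b * t).
split.
  rewrite -e1 -[LHS]mulr1 -cs.
  have -> : p t * (cos (b * t) ^+ 2 + sin (b * t) ^+ 2) =
    (p t * cos (b * t) + q t * sin (b * t)) * cos (b * t) -
    (q t * cos (b * t) - p t * sin (b * t)) * sin (b * t) by ring.
  by rewrite e2 mul0r subr0.
rewrite -e1 -[LHS]mulr1 -cs.
have -> : q t * (cos (b * t) ^+ 2 + sin (b * t) ^+ 2) =
  (p t * cos (b * t) + q t * sin (b * t)) * sin (b * t) +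
  (q t * cos (b * t) - p t * sin (b * t)) * cos (b * t) by ring.
by rewrite e2 mul0r addr0.
Unshelve. all: by end_near. Qed.

Lemma cvg_cexp z :
  series ((fun k => (k`!)%:R^-1 * z ^+ k) : nat -> C) @ \oo --> (cexp z : C).
Proof.
case: z => a b; rewrite series_complex.
have [pE qE] := lim_re_im_series a b 1.
rewrite /cexp /= (_ : _ * _ = (expR a * cos b) +i* (expR a * sin b)); last first.
  by apply/eqP; rewrite eq_complex /= !mul0r subr0 addr0 !eqxx.
move: pE qE; rewrite !mulr1 => <- <-; apply: cvg_complex.
  rewrite (_ : (fun n => _) = fun k => re_coef (a +i* b) k * 1 ^+ k); first exact: is_cvg_re_coef.
  by apply/funext => k; rewrite expr1n mulr1 Re_invfact.
rewrite (_ : (fun n => _) = fun k => im_coef (a +i* b) k * 1 ^+ k); first exact: is_cvg_im_coef.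
by apply/funext => k; rewrite expr1n mulr1 Im_invfact.
Qed.

Lemma cexpD (z w : R[i]) : cexp (z + w) = cexp z * cexp w.
Proof.
case: z w => a b [c d]; rewrite /cexp /= expRD cosD sinD.
by apply/eqP; rewrite eq_complex /=; apply/andP; split; apply/eqP; ring.
Qed.

Lemma cexp0 : cexp (0 : R[i]) = 1.
Proof. by rewrite /cexp /= expR0 cos0 sin0 mulr1. Qed.

End ComplexExp.

(** * The matrix exponential *)

Section MatrixExp.
Variable R : realType.
Local Notation C := (R[i] : numFieldType).

Definition mxexp n (M : 'M[R[i]]_n.+1) : 'M[R[i]]_n.+1 :=
  \matrix_(i, j) limn (series ((fun k => (k`!)%:R^-1 * (M ^+ k) i j) : nat -> C)).

Lemma cvg_mxexp n (M : 'M[R[i]]_n.+1) i j :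
  series ((fun k => (k`!)%:R^-1 * (M ^+ k) i j) : nat -> C) @ \oo -->
    (mxexp M i j : C).
Proof.
(* The sum [S] of the moduli of all entries satisfies [|(M^k) i j| <= S^k], so the exponential
   series of [S] dominates. *)
rewrite mxE; set S : R[i] := \sum_a \sum_b `|M a b|.
have SK : S = (complex.Re S)%:C.
  by rewrite RRe_real // realE sumr_ge0 // => a _; rewrite sumr_ge0.
apply: (@is_cvg_cseries_fact _ _ (complex.Re S)) => k.
have -> : (complex.Re S ^+ k)%:C = S ^+ k by rewrite [in RHS]SK -rmorphXn.
elim: k i j => [|k IHk] i j.
  by rewrite !expr0 mxE; case: eqP; rewrite ?normr1 ?normr0 ?ler01.
rewrite exprSr mxE (le_trans (ler_norm_sum _ _ _)) //.
apply: (@le_trans _ _ (\sum_l S ^+ k * `|M l j|)).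
  by apply: ler_sum => l _; rewrite normrM ler_wpM2r.
rewrite -mulr_sumr exprSr ler_wpM2l ?exprn_ge0 ?sumr_ge0 //.
  by move=> a _; rewrite sumr_ge0.
by apply: ler_sum => a _; rewrite (bigD1 j) //= lerDl sumr_ge0.
Qed.

Lemma trig_mxX (K : comNzRingType) n (U : 'M[K]_n.+1) k : is_trig_mx U ->
  is_trig_mx (U ^+ k) /\ forall i, (U ^+ k) i i = U i i ^+ k.
Proof.
move=> /is_trig_mxP trU; elim: k => [|k [/is_trig_mxP trk dk]].
  split; last by move=> i; rewrite !expr0 mxE eqxx.
  by apply/is_trig_mxP => i j ij; rewrite expr0 mxE -val_eqE /= ltn_eqF.
split.
  apply/is_trig_mxP => i j ij; rewrite exprSr mxE big1 // => l _.
  have [il|li] := ltnP i l; first by rewrite trk ?mul0r.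
  by rewrite trU ?mulr0 // (leq_ltn_trans li).
move=> i; rewrite !exprSr mxE (bigD1 i) //= dk big1 ?addr0 // => l li.
case: (ltngtP i l) => [il|il|/val_inj il]; first by rewrite trk ?mul0r.
  by rewrite trU ?mulr0.
by rewrite il eqxx in li.
Qed.

Lemma cvg_det n (A : nat -> 'M[R[i]]_n) (B : 'M[R[i]]_n) :
  (forall i j, ((fun m => A m i j) : nat -> C) @ \oo --> (B i j : C)) ->
  ((fun m => \det (A m)) : nat -> C) @ \oo --> (\det B : C).
Proof.
move=> AB; apply: (cvg_big add_continuous) => s _; apply: cvgM; first exact: cvg_cst.
by apply: (cvg_big mul_continuous) => i _; exact: AB.
Qed.

(* Triangularize: the partial sums of the exponential of a triangular matrix
   have the scalar partial sums on the diagonal. *)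
Lemma det_mxexp n (M : 'M[R[i]]_n.+1) : \det (mxexp M) = cexp (\tr M).
Proof.
pose S (A : 'M[R[i]]_n.+1) m := \sum_(0 <= k < m) (k`!)%:R^-1 *: A ^+ k.
have SE A m i j : S A m i j =
    series ((fun k => (k`!)%:R^-1 * (A ^+ k) i j) : nat -> C) m.
  by rewrite /S summxE; apply: eq_bigr => k _; rewrite mxE.
have [P Pu trU] := Schur M (ltn0Sn n).
have Pun := unitarymx_unit Pu.
move: trU; rewrite /similar_to conjumx // => trU; set U := _ *m _ in trU.
have UX k : U ^+ k = P *m M ^+ k *m invmx P.
  elim: k => [|k IHk]; first by rewrite !expr0 mulmx1 mulmxV.
  by rewrite !exprSr IHk -[LHS]/(_ *m _) /U !mulmxA mulmxKV.
have SU m : S U m = P *m S M m *m invmx P.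
  rewrite mulmx_sumr mulmx_suml; apply: eq_bigr => k _.
  by rewrite UX -scalemxAr -scalemxAl.
have detS m : \det (S M m) = \prod_i S U m i i.
  rewrite -det_trig.
    by rewrite SU !det_mulmx mulrAC -det_mulmx mulmxV // det1 mul1r.
  apply/is_trig_mxP => i j ij; rewrite summxE big1 // => k _.
  by rewrite mxE; have [/is_trig_mxP -> //] := trig_mxX k trU; rewrite mulr0.
have lim1 : ((fun m => \det (S M m)) : nat -> C) @ \oo --> (\det (mxexp M) : C).
  by apply: cvg_det => i j; under eq_fun do rewrite SE; exact: cvg_mxexp.
have lim2 : ((fun m => \det (S M m)) : nat -> C) @ \oo --> (\prod_i cexp (U i i) : C).
  under eq_fun do rewrite detS; apply: (cvg_big mul_continuous) => i _.
  under eq_fun do rewrite SE.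
  have Uii k : (U ^+ k) i i = U i i ^+ k by have [_ ->] := trig_mxX k trU.
  under [X in series X]eq_fun do rewrite Uii.
  exact: cvg_cexp.
rewrite (cvg_unique _ lim1 lim2) //.
have -> : \tr M = \tr U by rewrite /U mxtrace_mulC mulmxA mulVmx // mul1mx.
rewrite /mxtrace; elim: (index_enum _) => [|i r IHr]; first by rewrite !big_nil cexp0.
by rewrite !big_cons cexpD IHr.
Qed.

End MatrixExp.

(** * Determinants of finite rank perturbations of the identity *)

Section FiniteRank.
Variable R : realType.
Local Notation C := (R[i] : numFieldType).

(** The partial sums are constant along the finite sets containing [A]. *)
Lemma usum_fset (I : choiceType) (x : I -> R[i]) (A : {fset I}) :
  (forall i, i \notin A -> x i = 0) -> usum x = \sum_(i <- A) x i.
Proof.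
have FF : ProperFilter (@summability.totally I) := summability.totally_filter.
move=> x0; rewrite /usum /summability.sum; set l := \sum_(i <- A) x i.
suff xl : (summability.partial_sum (x : I -> C) @ summability.totally) --> (l : C).
  exact: (cvg_lim _ xl).
apply: cvg_near_cst; exists A => // B /= AB.
transitivity (\sum_(i <- B) x i); first by rewrite big_seq_fsetE.
by apply/esym/big_fset_incl => // i _ /x0.
Qed.

Lemma limn_near_cst (u : nat -> C) (l : R[i]) :
  (\forall k \near \oo, u k = l) -> limn u = l.
Proof. by move=> /cvg_near_cst; exact: cvg_lim. Qed.

Lemma det_row0 (K : comNzRingType) n (M : 'M[K]_n) i : (forall j, M i j = 0) -> \det M = 0.
Proof. by move=> M0; rewrite (expand_det_row _ i) big1 // => j _; rewrite M0 mul0r. Qed.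

Variables (n : nat) (e : 'I_n.+1 -> int).
Hypothesis e_inj : injective e.
Implicit Types (A B T : opZ R).

Definition compress A : 'M[R[i]]_n.+1 := \matrix_(i, j) mx_elt A (e i) (e j).

Let F : {fset int} := [fset e i | i in 'I_n.+1]%fset.

Let FP m : reflect (exists i, m = e i) (m \in F).
Proof.
apply: (iffP idP) => [/imfsetP[i _ ->]|[i ->]]; first by exists i.
by apply/imfsetP; exists i.
Qed.

Lemma principal_minor_compress A (S : {fset int}) : (S `<=` F)%fset ->
  principal_minor A S =
  \det (\matrix_(i, j) (if i \in [set i | e i \in S]%SET then compress A i j else (i == j)%:R)).
Proof.
move=> /fsubsetP SF.
have /fin_all_exists[f fE] (i : 'I_#|{: S}|) : exists j, e j = val (enum_val i).
  by have /FP[j ->] := SF _ (valP (enum_val i)); exists j.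
rewrite (@det_partial_rows _ _ _ _ _ f).
- by congr (\det _); apply/matrixP => i j; rewrite !mxE !fE.
- by move=> i j /(congr1 e); rewrite !fE => /val_inj/enum_val_inj.
move=> i; rewrite inE; apply/idP/codomP => [eiS|[j ->]]; last by rewrite fE; exact: valP.
by exists (enum_rank [` eiS]%fset); apply: e_inj; rewrite fE enum_rankK.
Qed.

(** Only subsets of [F] contribute, and they have at most [n.+1] elements; the series of exterior
    traces is thus a finite sum of principal minors, which [det_add1mx] identifies. *)
Lemma fredholm_det_compress A :
  (forall S : {fset int}, ~~ (S `<=` F)%fset -> principal_minor A S = 0) ->
  fredholm_det (id + A) = \det (1%:M + compress A).
Proof.
move=> A0; rewrite /fredholm_det (_ : id + A - id = A); last by rewrite addrC addKr.
have extE k : ext_trace A k = \sum_(S <- fpowerset F)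
    if #|` S| == k then principal_minor A S else 0.
  apply: usum_fset => S; rewrite fpowersetE => SF.
  by case: ifP => // _; exact: A0.
have cF (S : {fset int}) : S \in fpowerset F -> (#|` S| <= n.+1)%N.
  rewrite fpowersetE => /fsubset_leq_card /leq_trans -> //.
  by rewrite (leq_trans (leq_imfset_card _ _ _)) //= -cardE card_ord.
apply: limn_near_cst; near=> N.
rewrite /series /=; under eq_bigr do rewrite extE.
rewrite exchange_big /= det_add1mx.
(* For [N > n.+1], each [S] is counted exactly once, at [k] equal to its cardinality. *)
transitivity (\sum_(S <- fpowerset F) principal_minor A S).
  rewrite big_seq [RHS]big_seq; apply: eq_bigr => S /cF cS.
  rewrite -big_mkcond /= big_mkord.
  have SN : (#|` S| < N)%N.
    by apply: leq_ltn_trans cS _; near: N; exists n.+2.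
  by rewrite (big_pred1 (Ordinal SN)).
pose phi (S : {fset int}) := [set i | e i \in S]%SET.
pose G (S : {set 'I_n.+1}) :=
  \det (\matrix_(i, j) (if i \in S then compress A i j else (i == j)%:R)).
rewrite -[RHS]/(\sum_(S : {set 'I_n.+1}) G S).
transitivity (\sum_(S <- map phi (fpowerset F)) G S).
  rewrite big_map big_seq [RHS]big_seq; apply: eq_bigr => S.
  by rewrite fpowersetE => /principal_minor_compress ->.
apply: perm_big; apply: uniq_perm; rewrite ?index_enum_uniq //.
  rewrite map_inj_in_uniq ?fset_uniq // => S S'.
  rewrite !fpowersetE => /fsubsetP SF /fsubsetP SF' /setP phiE.
  apply/fsetP => m; apply/idP/idP => mS.
    have /FP[i mi] := SF _ mS.
    by have := phiE i; rewrite !inE -mi mS => <-.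
  have /FP[i mi] := SF' _ mS.
  by have := phiE i; rewrite !inE -mi mS => ->.
move=> S; rewrite mem_index_enum; apply/mapP.
exists [fset e i | i in S]%fset.
  rewrite fpowersetE; apply/fsubsetP => m /imfsetP[i _ ->].
  by apply/FP; exists i.
apply/setP => i; rewrite inE; apply/idP/imfsetP => [iS|[j jS /e_inj -> //]].
by exists i.
Unshelve. all: by end_near. Qed.

Lemma fredholm_det_rows A :
  (forall f m, (forall i, m != e i) -> A f m = 0) ->
  fredholm_det (id + A) = \det (1%:M + compress A).
Proof.
move=> A0; apply: fredholm_det_compress => S /fsubsetPn[m mS mF].
apply: (@det_row0 _ _ _ (enum_rank [` mS]%fset)) => j.
rewrite mxE enum_rankK /= /mx_elt A0 // => i.
by apply: contraNneq mF => ->; apply/FP; exists i.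
Qed.

(** Serves [(H0 - z)^-1 (H - H0)], whose values leave the window but which annihilates [delta k] for
    [k] outside. *)
Lemma fredholm_det_cols A :
  (forall k m, (forall i, k != e i) -> mx_elt A m k = 0) ->
  fredholm_det (id + A) = \det (1%:M + compress A).
Proof.
move=> A0; apply: fredholm_det_compress => S /fsubsetPn[m mS mF].
rewrite /principal_minor -det_tr.
apply: (@det_row0 _ _ _ (enum_rank [` mS]%fset)) => j.
rewrite !mxE enum_rankK /= A0 // => i.
by apply: contraNneq mF => ->; apply/FP; exists i.
Qed.

Definition lincomb (c : 'I_n.+1 -> R[i]) : seqZ R :=
  fun m => \sum_i c i * delta R (e i) m.

Lemma lincombE c i : lincomb c (e i) = c i.
Proof.
rewrite /lincomb (bigD1 i) //= /delta eqxx mulr1 big1 ?addr0 // => j ji.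
by rewrite eq_sym (inj_eq e_inj) (negbTE ji) mulr0.
Qed.

Lemma lincomb_out c m : (forall i, m != e i) -> lincomb c m = 0.
Proof. by move=> me; rewrite /lincomb big1 // => i _; rewrite /delta (negbTE (me i)) mulr0. Qed.

Lemma eq_lincomb f c : (forall i, f (e i) = c i) ->
  (forall m, (forall i, m != e i) -> f m = 0) -> f = lincomb c.
Proof.
move=> fe f0; apply/funext => m; have [/FP[i ->]|mF] := boolP (m \in F).
  by rewrite lincombE fe.
have me i : m != e i by apply: contraNneq mF => ->; apply/FP; exists i.
by rewrite lincomb_out ?f0.
Qed.

Lemma delta_lincomb j : delta R (e j) = lincomb (fun i => (i == j)%:R).
Proof.
apply: eq_lincomb => [i|m me]; first by rewrite /delta (inj_eq e_inj).
by rewrite /delta (negbTE (me j)).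
Qed.

Lemma opexp_out B f m : (forall f m, (forall i, m != e i) -> B f m = 0) ->
  (forall i, m != e i) -> opexp B f m = f m.
Proof.
move=> B0 me; apply: limn_near_cst; near=> N.
have N0 : (0 < N)%N by near: N; exists 1%N.
rewrite /series /= big_ltn //= fact0 invr1 mul1r big_nat big1 ?addr0 // => -[//|k] _.
by rewrite iterS B0 ?mulr0.
Unshelve. all: by end_near. Qed.

(** Operators are arbitrary maps, so linearity is assumed where it is used: on combinations of the
    [delta (e j)]. The iterates of [B] on these stay supported in the window. *)
Lemma opexp_delta B j :
  (forall f m, (forall i, m != e i) -> B f m = 0) ->
  (forall c i, B (lincomb c) (e i) = \sum_j c j * B (delta R (e j)) (e i)) ->
  opexp B (delta R (e j)) = lincomb (fun i => mxexp (compress B) i j).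
Proof.
move=> B0 Blin.
have iterE k : iter k B (delta R (e j)) = lincomb (fun i => (compress B ^+ k) i j).
  elim: k => [|k IHk].
    by rewrite expr0 /= delta_lincomb; congr lincomb; apply/funext => i; rewrite mxE.
  rewrite iterS IHk; apply: eq_lincomb => [i|m /B0 //].
  rewrite Blin exprS mxE; apply: eq_bigr => l _.
  by rewrite mxE mulrC.
apply: eq_lincomb => [i|m me]; last first.
  by rewrite opexp_out // /delta (negbTE (me j)).
rewrite mxE /opexp; under [X in series X]eq_fun do rewrite iterE lincombE.
by [].
Qed.

(** Since [e^(-A)] maps each [delta (e j)] into the window, the compression of [(1 + A) e^(-A)] is
    the product of the compressions, and [det_mxexp] evaluates the second factor. *)
Lemma det2_rows A :
  (forall f m, (forall i, m != e i) -> A f m = 0) ->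
  (forall c i, A (lincomb c) (e i) = \sum_j c j * A (delta R (e j)) (e i)) ->
  det2 (id + A) = \det (1%:M + compress A) * cexp (- \tr (compress A)).
Proof.
move=> A0 Alin; rewrite /det2.
have -> : id - (id + A) = - A by rewrite opprD addrA subrr sub0r.
have B0 f m : (forall i, m != e i) -> (- A) f m = 0.
  by move=> me; rewrite -[LHS]/(- A f m) A0 ?oppr0.
have Blin c i : (- A) (lincomb c) (e i) = \sum_j c j * (- A) (delta R (e j)) (e i).
  rewrite -[LHS]/(- A (lincomb c) (e i)) Alin -sumrN.
  by apply: eq_bigr => j _; rewrite -mulrN.
have CB : compress (- A) = - compress A by apply/matrixP => i j; rewrite !mxE.
set T := _ \o _; rewrite (_ : T = id + (T - id)); last by rewrite addrC subrK.
rewrite fredholm_det_rows.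
  have -> : 1%:M + compress (T - id) = (1%:M + compress A) *m mxexp (- compress A).
    rewrite mulmxDl mul1mx; apply/matrixP => i j.
    transitivity ((i == j)%:R + (T (delta R (e j)) (e i) - (e i == e j)%:R)).
      by rewrite !mxE.
    rewrite (inj_eq e_inj) addrC subrK /T /= opexp_delta //.
    rewrite -[LHS]/(lincomb _ (e i) + A (lincomb _) (e i)) Alin lincombE CB.
    rewrite [RHS]mxE [X in _ = _ + X]mxE; congr (_ + _).
    by apply: eq_bigr => l _; rewrite mulrC [compress _ _ _]mxE.
  by rewrite det_mulmx det_mxexp raddfN.
(* At points outside of the window both [1 + A] and [e^(-A)] leave values unchanged. *)
move=> f m me; rewrite -[LHS]/(opexp (- A) f m + A (opexp (- A) f) m - f m).
by rewrite A0 // opexp_out // addr0 subrr.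
Qed.

End FiniteRank.

(** * Square-summable sequences *)

Section Ell2.
Variable R : realType.
Implicit Types (f g h : seqZ R) (z w : R[i]).

Definition sqnormc z : R := complex.Re z ^+ 2 + complex.Im z ^+ 2.

Lemma sqnormcE z : complex.Re `|z| ^+ 2 = sqnormc z.
Proof. by rewrite normc_def /= sqr_sqrtr // addr_ge0 ?sqr_ge0. Qed.

Lemma sqnormc_ge0 z : 0 <= sqnormc z.
Proof. by rewrite addr_ge0 ?sqr_ge0. Qed.

Lemma le_sqnormc z w : (sqnormc z <= sqnormc w) = (`|z| <= `|w|).
Proof.
rewrite -!sqnormcE !normc_def lecR /= ler_sqr ?nnegrE ?sqrtr_ge0 //.
Qed.

Lemma ell2E f : ell2 f = (\esum_(n in [set: int]) (sqnormc (f n))%:E < +oo)%E.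
Proof. by congr (_ < _)%E; apply: eq_esum => n _; rewrite sqnormcE. Qed.

Lemma le_ell2 f g : (forall n, `|f n| <= `|g n|) -> ell2 g -> ell2 f.
Proof.
move=> fg; rewrite !ell2E; apply: le_lt_trans; apply: le_esum => n _.
by rewrite lee_fin le_sqnormc.
Qed.

Lemma ell2D f g : ell2 f -> ell2 g -> ell2 (f + g).
Proof.
rewrite !ell2E => f2 g2.
pose F n := (sqnormc (f n))%:E; pose G n := (sqnormc (g n))%:E.
have F0 n : (0 <= F n)%E by rewrite lee_fin sqnormc_ge0.
have G0 n : (0 <= G n)%E by rewrite lee_fin sqnormc_ge0.
(* This is [|x + y|^2 <= 2 |x|^2 + 2 |y|^2], with difference [|x - y|^2]; the factor 2 is spelled as
   a repeated sum to suit [esumD]. *)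
have sqD (a b c d : R) : (a + c) ^+ 2 + (b + d) ^+ 2 <=
    a ^+ 2 + b ^+ 2 + (c ^+ 2 + d ^+ 2) + (a ^+ 2 + b ^+ 2 + (c ^+ 2 + d ^+ 2)).
  rewrite -subr_ge0 (_ : _ - _ = (a - c) ^+ 2 + (b - d) ^+ 2); last by ring.
  by rewrite addr_ge0 ?sqr_ge0.
apply: (@le_lt_trans _ _ (\esum_(n in setT) ((F n + G n) + (F n + G n)))%E).
  apply: le_esum => n _; rewrite /F /G -!EFinD lee_fin /sqnormc.
  rewrite -[(f + g) n]/(f n + g n); case: (f n) (g n) => a b [c d].
  exact: sqD.
have fgD : (\esum_(n in setT) (F n + G n) < +oo)%E.
  by rewrite esumD // lte_add_pinfty.
by rewrite esumD ?lte_add_pinfty // => n _; rewrite adde_ge0.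
Qed.

Lemma ell2_reindex (t : int -> int) f : bijective t -> ell2 f -> ell2 (f \o t).
Proof.
by rewrite -setTT_bijective => tb; rewrite !ell2E (reindex_esum setT setT t).
Qed.

Lemma ell2_bounded (K : R) f g :
  (forall n, `|f n| <= K%:C * `|g n|) -> ell2 g -> ell2 f.
Proof.
(* [K] is rounded up to a natural number, so that the bound is a repeated sum of [g] and [ell2D]
   applies. *)
move=> fg g2; pose m := Num.truncn `|K|.
have Km : K <= m.+1%:R by rewrite (le_trans (ler_norm _)) // ltW // truncnS_gt.
apply: (@le_ell2 _ (g *+ m.+1)) => [n|].
  have -> : (g *+ m.+1) n = g n *+ m.+1 by elim: (m.+1) => // k IHk; rewrite !mulrS -IHk.
  rewrite normrMn -mulr_natl (le_trans (fg n)) // ler_wpM2r //.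
  by rewrite -(rmorph_nat (real_complex R)) lecR.
by elim: m {Km} => [|k IHk]; rewrite ?mulr1n // mulrS; exact: ell2D.
Qed.

Lemma ell2Z (c : R[i]) f : ell2 f -> ell2 (fun n => c * f n).
Proof.
apply: (@ell2_bounded (complex.Re `|c|)) => n.
by rewrite normrM RRe_real // realE normr_ge0.
Qed.

Lemma ell2N f : ell2 f -> ell2 (- f).
Proof. by apply: le_ell2 => n; rewrite -[(- f) n]/(- f n) normrN. Qed.

Lemma ell2B f g : ell2 f -> ell2 g -> ell2 (f - g).
Proof. by move=> f2 /ell2N; exact: ell2D. Qed.

Lemma esum_int_nat (F : int -> \bar R) : (forall n, 0 <= F n)%E ->
  (\esum_(n in [set: int]) F n = \sum_(0 <= i <oo) F (Posz i) + \sum_(0 <= i <oo) F (Negz i))%E.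
Proof.
move=> F0; rewrite (esumID (range Posz)) // setTI.
have -> : [set: int] `&` ~` range Posz = range Negz.
  apply/seteqP; split => [[i|i] [_] /=|_ [i _ <-]].
  - by case; exists i.
  - by exists i.
  - by split => // -[].
rewrite !esum_image ?nneseries_esumT //.
- by move=> i j _ _ [].
- by move=> i j _ _ [].
Qed.

Lemma ell2_geometric (q : R[i]) : `|q| < 1 -> ell2 (fun n : int => q ^+ `|n|%N).
Proof.
move=> q1; set r := sqnormc q.
have r1 : r < 1.
  rewrite /r -sqnormcE -[ltRHS](expr1n _ 2) ltr_sqr ?nnegrE //.
    by move: q1; rewrite normc_def /= -[1]/(1%:C) ltcR.
  by rewrite normc_def /= sqrtr_ge0.
have r0 : 0 <= r := sqnormc_ge0 q.
have sqX i : sqnormc (q ^+ i) = r ^+ i.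
  rewrite /r -!sqnormcE normrX !normc_def -rmorphXn /=.
  by rewrite -!exprM mulnC.
rewrite ell2E esum_int_nat => [|n]; last by rewrite lee_fin sqnormc_ge0.
(* One geometric bound for both halves of Z: the exponent is [i] at [Posz i] and [i.+1] at
   [Negz i]. *)
have bnd (u : nat -> nat) : (forall i, i <= u i)%N ->
    (\sum_(0 <= i <oo) (sqnormc (q ^+ u i))%:E < +oo)%E.
  move=> iu; apply: (@le_lt_trans _ _ ((1 - r)^-1)%:E); last exact: ltry.
  apply: lime_le; first by apply: is_cvg_nneseries => n _ _; rewrite lee_fin sqnormc_ge0.
  apply: nearW => k; rewrite sumEFin lee_fin.
  apply: (@le_trans _ _ (\sum_(0 <= i < k) r ^+ i)).
    by apply: ler_sum => i _; rewrite sqX ler_wiXn2l // ltW.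
  rewrite -[leRHS]mul1r ler_pdivlMr ?subr_gt0 //.
  rewrite big_mkord mulrC -opprB mulNr -subrX1 opprB lerBlDr lerDl exprn_ge0 //.
by rewrite lte_add_pinfty // bnd.
Qed.

(** Leftwards from a point where [h] is nonzero the moduli do not decrease, so infinitely many terms
    exceed a fixed [c > 0]. *)
Lemma ell2_nonincreasing h : ell2 h ->
  (forall n, `|h (n + 1)| <= `|h n|) -> h = 0.
Proof.
move=> + hle; rewrite ell2E => h2; apply/funext => n0; apply/eqP.
rewrite -normr_le0 -[leRHS](@normr0 _ R[i]) -le_sqnormc.
have s00 : sqnormc 0 = 0 by rewrite /sqnormc /= expr0n addr0.
rewrite s00 leNgt; apply/negP; set c := sqnormc _ => c0.
have hge k : c <= sqnormc (h (n0 - k%:Z)).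
  rewrite /c le_sqnormc; elim: k => [|k IHk]; first by rewrite subr0.
  apply: le_trans IHk _; have := hle (n0 - k.+1%:Z); congr (`|h _| <= _); lia.
have sum_le K : ((c *+ K)%:E <= \esum_(n in [set: int]) (sqnormc (h n))%:E)%E.
  pose t (k : nat) : int := n0 - k%:Z.
  have tinj : set_inj setT t by move=> i j _ _; rewrite /t => ij; lia.
  rewrite (esumID (range t)) => [|n _]; last by rewrite lee_fin sqnormc_ge0.
  rewrite setTI esum_image // -nneseries_esumT; last by move=> n; rewrite lee_fin sqnormc_ge0.
  rewrite (@le_trans _ _ (\sum_(0 <= i <oo) (sqnormc (h (t i)))%:E)%E) //.
    apply: le_trans (nneseries_lim_ge K _) => [|n _ _]; last by rewrite lee_fin sqnormc_ge0.
    rewrite sumEFin lee_fin -[in leLHS](subn0 K) -sumr_const_nat.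
    by apply: ler_sum => i _; exact: hge.
  by rewrite leeDl // esum_ge0 // => n _; rewrite lee_fin sqnormc_ge0.
move: h2 sum_le; case: (esum _ _) => [s _ sum_le||_ /(_ 0%N)] //.
(* This many terms, each at least [c], exceed the total [s]. *)
have := sum_le (Num.truncn (s / c)).+1; rewrite lee_fin leNgt => /negP; apply.
by rewrite -mulr_natl -ltr_pdivrMr // truncnS_gt.
Qed.

(** Uniqueness of square-summable solutions is what makes the choice in [opinv A] a left inverse of
    [A] on l^2. *)
Definition ell2_injective (A : opZ R) :=
  forall f g, ell2 f -> ell2 g -> A f = A g -> f = g.

Lemma opinvK A f : ell2_injective A -> ell2 f -> opinv A (A f) = f.
Proof.
move=> Ainj f2; apply: xget_unique; first by split.
by move=> g [g2 Agf]; apply: Ainj.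
Qed.

(** The difference [h] of two solutions satisfies [h (n + 1) = a n * h n], so its modulus is
    nonincreasing. *)
Lemma shiftL_diag_injective (a : int -> R[i]) : (forall n, `|a n| <= 1) ->
  ell2_injective (shiftL - diag a).
Proof.
move=> a1 f g f2 g2 fg; apply/eqP; rewrite -subr_eq0; apply/eqP.
apply: ell2_nonincreasing => [|n]; first exact: ell2B.
have /(congr1 (fun u : seqZ R => u n)) := fg.
rewrite -[LHS]/(f (n + 1) - a n * f n) -[RHS]/(g (n + 1) - a n * g n) => fgn.
rewrite -[(f - g) n]/(f n - g n) -[(f - g) _]/(f (n + 1) - g (n + 1)).
have -> : f (n + 1) - g (n + 1) = a n * (f n - g n).
  by rewrite mulrBr -(subrK (a n * f n) (f (n + 1))) fgn; ring.
by rewrite normrM ler_piMl.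
Qed.

(** The reflection [n -> - n] exchanges the two shifts. *)
Lemma shiftR_diag_injective (a : int -> R[i]) : (forall n, `|a n| <= 1) ->
  ell2_injective (shiftR - diag a).
Proof.
move=> a1 f g f2 g2 fg.
have oppb : bijective (-%R : int -> int) by exists -%R; exact: opprK.
suff : f \o -%R = g \o -%R.
  move=> fgo; apply/funext => n; rewrite -(opprK n).
  exact: (congr1 (fun u : seqZ R => u (- n)) fgo).
apply: (@shiftL_diag_injective (a \o -%R)) => [n|||]; rewrite /= ?a1 //.
- exact: ell2_reindex.
- exact: ell2_reindex.
apply/funext => n; have /(congr1 (fun u : seqZ R => u (- n))) := fg.
rewrite -[LHS]/(f (- n - 1) - a (- n) * f (- n)) -[RHS]/(g (- n - 1) - a (- n) * g (- n)).
by rewrite -opprD.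
Qed.

Lemma ell2_shiftL f : ell2 f -> ell2 (shiftL f).
Proof.
apply: ell2_reindex; exists (fun n => n - 1) => n; [exact: addrK|exact: subrK].
Qed.

Lemma ell2_shiftR f : ell2 f -> ell2 (shiftR f).
Proof.
apply: ell2_reindex; exists (fun n => n + 1) => n; [exact: subrK|exact: addrK].
Qed.

Lemma ell2_diag (a : int -> R[i]) f : (forall n, `|a n| <= 1) -> ell2 f -> ell2 (diag a f).
Proof. by move=> a1; apply: le_ell2 => n; rewrite normrM ler_piMl. Qed.

(** [(L - q)(R - q) = - q (H0 - z)], and both factors on the left are injective on l^2. *)
Lemma H0_injective (q z : R[i]) : q != 0 -> `|q| <= 1 -> q + q^-1 = z ->
  ell2_injective (H0 - diag (fun=> z)).
Proof.
move=> q0 q1 qz f g f2 g2 fg.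
apply: (@shiftR_diag_injective (fun=> q)) => //.
have r2 u : ell2 u -> ell2 ((shiftR - diag (fun=> q)) u).
  by move=> u2; apply: ell2B; [exact: ell2_shiftR|exact: ell2_diag].
apply: (@shiftL_diag_injective (fun=> q)) => //; [exact: r2|exact: r2|].
have H0E u n : (shiftL - diag (fun=> q)) ((shiftR - diag (fun=> q)) u) n =
    - q * (H0 - diag (fun=> z)) u n.
  rewrite -[LHS]/((u (n + 1 - 1) - q * u (n + 1)) - q * (u (n - 1) - q * u n)).
  rewrite -[(H0 - _) u n]/(u (n + 1) + u (n - 1) - z * u n) addrK -qz; field.
  exact: q0.
by apply/funext => n; rewrite !H0E fg.
Qed.

End Ell2.

(** * Tridiagonal matrices *)

Section Tridiagonal.
Variables (K : comNzRingType) (b : int) (m : nat) (q : K).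
Local Notation N := m.+2.
Local Ltac sring := rewrite /=; ring.
Implicit Types (d al be l f : int -> K) (c : 'I_N -> K).

Definition site (i : 'I_N) : int := b + i%:Z.

Definition tridiag d al be f : int -> K :=
  fun k => d k * f k - al k * f (k + 1) - be k * f (k - 1).

(* The corner corrections [- q ^+ 2] account for the geometric continuation of
   a vector outside of the window, see [trimx_mul]. *)
Definition trimx d al be : 'M[K]_N := \matrix_(i, j)
  ((i == j)%:R * (d (site i) - (i == 0 :> nat)%:R * q ^+ 2 - (i == m.+1 :> nat)%:R * q ^+ 2)
   - (i.+1 == j :> nat)%:R * al (site i) - (i == j.+1 :> nat)%:R * be (site i)).

(** Inside the window the truncated subtraction gives exponent 0; to its right [minn] clamps the
    index to the last site. [Negz i] lies at distance [i.+1] to the left of [b]. *)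
Definition geoext c : int -> K := fun k =>
  match k - b with
  | Posz i => q ^+ (i - m.+1) * c (inord (minn i m.+1))
  | Negz i => q ^+ i.+1 * c ord0
  end.

Lemma site_inj : injective site.
Proof. by move=> i j /addrI[] /val_inj. Qed.

Lemma geoextE c i : geoext c (site i) = c i.
Proof.
rewrite /geoext /site addrC addKr.
have im : (i <= m.+1)%N by rewrite -ltnS.
rewrite (_ : (i - m.+1)%N = 0%N) ?expr0 ?mul1r; last by lia.
by rewrite (minn_idPl im) inord_val.
Qed.

Lemma geoext_left c k : k <= b -> geoext c (k - 1) = q * geoext c k.
Proof.
move=> kb; have [i ->] : exists i : nat, k = b - i%:Z by exists (absz (b - k)%R); lia.
rewrite /geoext; case: i => [|i].
  rewrite (_ : b - 0%:Z - 1 - b = Negz 0); last by lia.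
  rewrite (_ : b - 0%:Z - b = Posz 0); last by lia.
  rewrite expr1 sub0n expr0 mul1r min0n; congr (_ * c _).
  by apply: val_inj; rewrite /= inordK.
rewrite (_ : b - i.+1%:Z - 1 - b = Negz i.+1); last by lia.
rewrite (_ : b - i.+1%:Z - b = Negz i); last by lia.
by rewrite exprS mulrA.
Qed.

Lemma geoext_right c k : b + m.+1%:Z <= k -> geoext c (k + 1) = q * geoext c k.
Proof.
move=> kb; have [i ->] : exists i : nat, k = b + (m.+1 + i)%:Z
  by exists (absz (k - (b + m.+1%:Z))%R); lia.
rewrite /geoext (_ : b + (m.+1 + i)%:Z + 1 - b = Posz (m.+1 + i.+1)); last by lia.
rewrite (_ : b + (m.+1 + i)%:Z - b = Posz (m.+1 + i)); last by lia.
rewrite !addKn (minn_idPr _) ?leq_addr // (minn_idPr _) ?leq_addr //.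
by rewrite exprS mulrA.
Qed.

Lemma sum_delta n (F : nat -> K) j :
  \sum_(k < n) (j == k :> nat)%:R * F k = if (j < n)%N then F j else 0.
Proof.
case: ltnP => jn; last first.
  rewrite big1 // => k _; rewrite gtn_eqF ?mul0r //.
  exact: leq_trans (ltn_ord k) jn.
rewrite (bigD1 (Ordinal jn)) //= eqxx mul1r big1 ?addr0 // => k kj.
by rewrite (_ : (j == k :> nat) = false) ?mul0r // eq_sym; apply/negbTE.
Qed.

Lemma sum_deltaS n (F : nat -> K) j :
  \sum_(k < n) (j == k.+1 :> nat)%:R * F k = if j is i.+1 then if (i < n)%N then F i else 0 else 0.
Proof.
case: j => [|j]; first by rewrite big1 // => k _; rewrite mul0r.
by under eq_bigr do rewrite eqSS; exact: sum_delta.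
Qed.

(** At an end site the outer neighbour carries [q] times the end value and has coefficient [q],
    which amounts to [- q ^+ 2] on the diagonal. *)
Lemma trimx_mul d al be c i : be b = q -> al (b + m.+1%:Z) = q ->
  \sum_j trimx d al be i j * c j = tridiag d al be (geoext c) (site i).
Proof.
move=> beb alb; pose f := geoext c.
have cE j : c j = f (b + (j : nat)%:Z) by rewrite -geoextE.
pose D := d (site i) - (i == 0 :> nat)%:R * q ^+ 2 - (i == m.+1 :> nat)%:R * q ^+ 2.
under eq_bigr => j _ do rewrite mxE cE -val_eqE /= -/D !mulrBl.
rewrite !sumrB.
under eq_bigr do rewrite -mulrA.
rewrite (sum_delta _ (fun k => D * f (b + k%:Z))) ltn_ord.
under eq_bigr do rewrite -mulrA.
rewrite (sum_delta _ (fun k => al (site i) * f (b + k%:Z))).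
under eq_bigr do rewrite -mulrA.
rewrite (sum_deltaS _ (fun k => be (site i) * f (b + k%:Z))).
rewrite /tridiag -/f /D /site.
have iN := ltn_ord i.
have fl : f (b - 1) = q * f b by apply: geoext_left.
have fr : f (b + m.+1%:Z + 1) = q * f (b + m.+1%:Z) by apply: geoext_right.
case: (nat_of_ord i) iN => [|k] kN.
  by rewrite eqxx /= !addr0 beb fl; sring.
rewrite /= (ltnW kN) !eqSS.
rewrite (_ : b + k.+1%:Z - 1 = b + k%:Z); last by lia.
case: eqP => [->|km].
  by rewrite ltnn alb fr; sring.
have -> : (k.+2 < N)%N by lia.
by rewrite (_ : b + k.+2%:Z = b + k.+1%:Z + 1); [sring|lia].
Qed.

(** There the equation is [(1 + q^2) f k = q f (k + 1) + q f (k - 1)], solved by geometric sequences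
    of ratio [q] or [1/q]. *)
Lemma tridiag_out d al be c k : k < b \/ b + m.+1%:Z < k ->
  d k = 1 + q ^+ 2 -> al k = q -> be k = q -> tridiag d al be (geoext c) k = 0.
Proof.
rewrite /tridiag => + -> -> ->; case=> kb.
  have e1 : geoext c (k - 1) = q * geoext c k by apply: geoext_left; lia.
  have e2 : geoext c k = q * geoext c (k + 1).
    by rewrite -geoext_left ?addrK //; lia.
  by rewrite e1 e2; sring.
have e1 : geoext c (k + 1) = q * geoext c k by apply: geoext_right; lia.
have e2 : geoext c k = q * geoext c (k - 1).
  by rewrite -geoext_right ?subrK //; lia.
by rewrite e1 e2; sring.
Qed.

Lemma det_LDLT (A L : 'M[K]_N) (D : 'rV[K]_N) : is_trig_mx L -> (forall i, L i i = 1) ->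
  A = L *m diag_mx D *m L^T -> \det A = \prod_i D 0 i.
Proof.
move=> trL L1 ->; rewrite !det_mulmx det_tr det_diag det_trig //.
by rewrite big1 ?mul1r ?mulr1.
Qed.

Lemma det_UDUT (A U : 'M[K]_N) (D : 'rV[K]_N) : is_trig_mx U^T -> (forall i, U i i = 1) ->
  A = U *m diag_mx D *m U^T -> \det A = \prod_i D 0 i.
Proof.
move=> trU U1 ->; rewrite !det_mulmx -[\det U]det_tr det_diag det_trig //.
by rewrite big1 ?mul1r ?mulr1 // => i _; rewrite mxE.
Qed.

(** [L] is unit lower bidiagonal. At the first site the correction cancels [l b ^+ 2], so all pivots
    are 1 up to the last one, where the other correction leaves [1 - q ^+ 2]. *)
Lemma det_trimx_LR l : l b = q -> l (b + m.+1%:Z) = q ->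
  \det (trimx (fun k => 1 + l k ^+ 2) (fun k => l (k + 1)) l) = 1 - q ^+ 2.
Proof.
move=> lb lm; pose L : 'M[K]_N := \matrix_(i, k)
  ((i == k :> nat)%:R - (i == k.+1 :> nat)%:R * l (site i)).
pose D : 'rV[K]_N := \row_k (1 - (k == m.+1 :> nat)%:R * q ^+ 2).
rewrite (@det_LDLT _ L D).
- rewrite (bigD1 ord_max) //= mxE eqxx mul1r big1 ?mulr1 // => k km.
  by rewrite mxE (negbTE (km : k != m.+1 :> nat)) mul0r subr0.
- apply/is_trig_mxP => i k ik; rewrite mxE.
  have -> : (i == k :> nat) = false by lia.
  have -> : (i == k.+1 :> nat) = false by lia.
  by rewrite mul0r subr0.
- move=> i; rewrite mxE eqxx; have -> : (i == i.+1 :> nat) = false by lia.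
  by rewrite mul0r subr0.
apply/matrixP => i j; rewrite mul_mx_diag !mxE.
(* [G k] is the entry [(i, k)] of [L D], extended to all naturals; row [j] of [L] has at most two
   nonzero entries, so the sum over [k] collapses. *)
pose G k := ((i == k :> nat)%:R - (i == k.+1 :> nat)%:R * l (site i)) *
  (1 - (k == m.+1 :> nat)%:R * q ^+ 2).
transitivity (\sum_(k < N) ((j == k :> nat)%:R * G k -
    (j == k.+1 :> nat)%:R * (l (site j) * G k))); last first.
  by apply: eq_bigr => k _; rewrite !mxE /G; sring.
rewrite sumrB (sum_delta _ G) (sum_deltaS _ (fun k => l (site j) * G k))
  ltn_ord -val_eqE /= /G /site.
have jN := ltn_ord j; have iN := ltn_ord i.
case: (nat_of_ord j) jN => [|k] kN.
  rewrite subr0 /=; case: (nat_of_ord i) iN => [|[|i']] iN /=.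
  - by rewrite addr0 lb; sring.
  - by sring.
  - by sring.
rewrite ltnW //.
have -> : (k == m.+1) = false by lia.
have [->|ik] := eqVneq (nat_of_ord i) k.
  rewrite eqxx; have -> : (k == k.+1) = false by lia.
  have -> : (k == k.+2) = false by lia.
  rewrite /= (_ : b + k%:Z + 1 = b + k.+1%:Z); last by lia.
  sring.
have [->|ik1] := eqVneq (nat_of_ord i) k.+1.
  rewrite !eqSS; have -> : (k.+1 == k) = false by lia.
  have -> : (k == k.+1) = false by lia.
  by sring.
have -> : (i.+1 == k.+1 :> nat) = false by rewrite eqSS; exact/negbTE.
have [ik2|ik2] := eqVneq (nat_of_ord i) k.+2.
  by rewrite (_ : (k.+1 == m.+1) = false); [sring|lia].
sring.
Qed.

(** Mirror image: elimination starts from the last site, and the exceptional pivot is at the first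
    one. *)
Lemma det_trimx_RL l : l b = q -> l (b + m.+1%:Z) = q ->
  \det (trimx (fun k => 1 + l k ^+ 2) l (fun k => l (k - 1))) = 1 - q ^+ 2.
Proof.
move=> lb lm; pose U : 'M[K]_N := \matrix_(i, k)
  ((i == k :> nat)%:R - (i.+1 == k :> nat)%:R * l (site i)).
pose D : 'rV[K]_N := \row_k (1 - (k == 0 :> nat)%:R * q ^+ 2).
rewrite (@det_UDUT _ U D).
- rewrite (bigD1 ord0) //= mxE mul1r big1 ?mulr1 // => k km.
  by rewrite mxE (negbTE (km : k != 0 :> nat)) mul0r subr0.
- apply/is_trig_mxP => i k ik; rewrite !mxE.
  have -> : (k == i :> nat) = false by lia.
  have -> : (k.+1 == i :> nat) = false by lia.
  by rewrite mul0r subr0.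
- move=> i; rewrite mxE eqxx; have -> : (i.+1 == i :> nat) = false by lia.
  by rewrite mul0r subr0.
apply/matrixP => i j; rewrite mul_mx_diag !mxE.
pose G k := ((i == k :> nat)%:R - (i.+1 == k :> nat)%:R * l (site i)) *
  (1 - (k == 0 :> nat)%:R * q ^+ 2).
transitivity (\sum_(k < N) ((j == k :> nat)%:R * G k -
    (j.+1 == k :> nat)%:R * (l (site j) * G k))); last first.
  by apply: eq_bigr => k _; rewrite !mxE /G; sring.
rewrite sumrB (sum_delta _ G) (sum_delta _ (fun k => l (site j) * G k))
  ltn_ord -val_eqE /= /G /site.
have jN := ltn_ord j; have iN := ltn_ord i.
have [ij|ij] := eqVneq (nat_of_ord i) j.
  rewrite ij eqxx; have -> : (j.+1 == j :> nat) = false by lia.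
  have -> : (j == j.+1 :> nat) = false by lia.
  have [jm|jm] := eqVneq (nat_of_ord j) m.+1.
    by rewrite jm ltnn lm; sring.
  by rewrite (_ : (j.+1 < N)%N); [sring|lia].
have [ij1|ij1] := eqVneq i.+1 (nat_of_ord j).
  rewrite -ij1 (_ : (i == i.+2 :> nat) = false); last by lia.
  rewrite (_ : (i.+1 == i.+2 :> nat) = false); last by lia.
  by case: ifP => _ /=; sring.
have [ij2|ij2] := eqVneq (nat_of_ord i) j.+1.
  rewrite -ij2 ltn_ord (_ : (i.+1 == i :> nat) = false); last by lia.
  rewrite (_ : (i == 0 :> nat) = false); last by lia.
  rewrite (_ : b + i%:Z - 1 = b + j%:Z); last by lia.
  sring.
rewrite (_ : (i.+1 == j.+1 :> nat) = false); last by rewrite eqSS; exact/negbTE.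
by case: ifP => _; sring.
Qed.

End Tridiagonal.

(** * The roots of [l + 1/l = z] *)

Section Joukowski.
Variable R : realType.
Implicit Types z : R[i].

(** [l] and [u] are the roots of [x^2 - z x + 1], so [l u = 1] and [l |u|^2] is the conjugate of
    [u]. The choice of the root gives [Im u > 0]; then [Im l + Im u = Im z > 0] forces [|u| > 1]. *)
Lemma joukowskiP z : 0 < complex.Im z ->
  [/\ joukowski z != 0, `|joukowski z| < 1 & joukowski z + (joukowski z)^-1 = z].
Proof.
move=> z0; rewrite /joukowski; set s := sqrtC _.
have ss : s ^+ 2 = z ^+ 2 - 4 by rewrite sqrtCK.
have s0 : 0 <= complex.Im s.
  by rewrite -lecR complexIm Im_rootC_ge0.
set l := (z - s) / 2; set u := (z + s) / 2.
have two0 : (2 : R[i]) != 0 by rewrite pnatr_eq0.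
have lu : l * u = 1.
  have -> : l * u = (z ^+ 2 - s ^+ 2) / 4 by rewrite /l /u; field.
  by rewrite ss opprB addrC subrK divff // pnatr_eq0.
have lu_add : l + u = z by rewrite /l /u; field.
have l0 : l != 0 by apply/eqP => l0; move/eqP: lu; rewrite l0 mul0r eq_sym oner_eq0.
have ul : u = l^-1 by rewrite -[LHS]mul1r -(mulVf l0) -mulrA lu mulr1.
split; [exact: l0| |by rewrite -ul].
have u2 : u + u = z + s by rewrite /u; field.
have Imu : 0 < complex.Im u.
  have : 0 < complex.Im (u + u) by rewrite u2 raddfD /= ltr_pwDl.
  by rewrite raddfD /= -mulr2n pmulrn_lgt0.
have : 1 < `|u|.
  have : l * (u * u^*%C) = u^*%C by rewrite mulrA lu mul1r.
  move: z0; rewrite -lu_add; case: (u) Imu => a b /= b0; case: (l) => c d /=.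
  rewrite normc_def /= -[1]/(1%:C) ltcR => db [_] e2.
  have {}e2 : d * (a ^+ 2 + b ^+ 2) = - b by rewrite -e2; ring.
  rewrite -sqrtr1 ltr_sqrt; last first.
    by rewrite ltr_wpDl ?sqr_ge0 // exprn_gt0.
  have N0 : 0 < a ^+ 2 + b ^+ 2 by rewrite ltr_wpDl ?sqr_ge0 // exprn_gt0.
  have : 0 < b * (a ^+ 2 + b ^+ 2 - 1).
    rewrite (_ : b * _ = (d + b) * (a ^+ 2 + b ^+ 2)) ?mulr_gt0 //.
    by rewrite mulrDl e2; ring.
  by rewrite pmulr_rgt0 // subr_gt0.
by rewrite ul normfV invf_gt1 // normr_gt0.
Qed.
End Joukowski.

(** * Solutions with geometric tails *)

Section Window.
Variables (R : realType) (b : int) (m : nat) (q : R[i]).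
Local Notation N := m.+2.
Local Notation pos := (@site b m).
Local Notation gext := (geoext b q).
Local Notation tmx := (trimx b m q).
Local Notation lc := (lincomb (R := R) pos).
Implicit Types (d al be : int -> R[i]) (c : 'I_N -> R[i]).

Lemma ell2_geoext c : q != 0 -> `|q| < 1 -> ell2 (gext c).
Proof.
move=> q0 q1.
pose S := \sum_i `|c i|.
have S0 : 0 <= S by rewrite sumr_ge0.
have cS i : `|c i| <= S by rewrite /S (bigD1 i) //= lerDl sumr_ge0.
have qm0 : 0 < `|q| ^+ m.+1 by rewrite exprn_gt0 // normr_gt0.
(* The exponent in [geoext] lags behind [|k - b|] by at most [m.+1], which the division by
   [|q| ^+ m.+1] absorbs. *)
pose T := S / `|q| ^+ m.+1.
have T0 : 0 <= T by rewrite divr_ge0 // ltW.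
have g2 : ell2 (fun n : int => q ^+ `|n - b|%N).
  apply: (ell2_reindex (t := fun n => n - b)) (ell2_geometric q1).
  by exists (fun n => n + b) => n; [exact: subrK|exact: addrK].
apply: (@ell2_bounded _ (complex.Re T)) g2 => k.
rewrite RRe_real; last by rewrite realE T0.
have bound e x : (`|k - b| <= e + m.+1)%N -> `|q ^+ e * c x| <= T * `|q ^+ `|k - b|%N|.
  move=> ke; rewrite normrM !normrX /T mulrAC ler_pdivlMr // mulrAC -exprD mulrC.
  by rewrite ler_pM ?exprn_ge0 // ler_wiXn2l // ltW.
by rewrite /geoext; case: (k - b) bound => i bound; apply: bound => /=; lia.
Qed.

Lemma site_out k : (forall i, k != pos i) -> k < b \/ b + m.+1%:Z < k.
Proof.
move=> kn; have [kb|bk] := ltP k b; [by left|right; rewrite ltNge; apply/negP => km].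
have h : (absz (k - b)%R < N)%N by lia.
have /eqP := kn (Ordinal h); apply; rewrite /site /=; lia.
Qed.

(** For [X] the inverse of a corrected window matrix, this is the solution with right-hand side [c]:
    the vector [X c] continued geometrically. *)
Definition window_sol (X : 'M[R[i]]_N) c : seqZ R :=
  gext (fun i => \sum_j c j * X i j).

Lemma window_solE X c k : window_sol X c k =
  \sum_j c j * window_sol X (fun i => (i == j)%:R) k.
Proof.
have E (j : 'I_N) : (fun i => \sum_l (l == j)%:R * X i l) = (fun i => X i j).
  apply/funext => i; rewrite (bigD1 j) //= eqxx mul1r big1 ?addr0 // => l lj.
  by rewrite (negbTE lj) mul0r.
under eq_bigr => j _ do rewrite /window_sol E.
rewrite /window_sol /geoext; case: (k - b) => i; rewrite mulr_sumr.
  by apply: eq_bigr => j _; rewrite mulrCA.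
by apply: eq_bigr => j _; rewrite mulrCA.
Qed.

Lemma window_sol_site X (i j : 'I_N) : window_sol X (fun l => (l == j)%:R) (pos i) = X i j.
Proof.
rewrite /window_sol geoextE (bigD1 j) //= eqxx mul1r big1 ?addr0 // => l lj.
by rewrite (negbTE lj) mul0r.
Qed.

(** [trimx_mul] handles the sites of the window and [tridiag_out] the rest. At an end site, the
    off-diagonal coefficient set to [q] is the one pointing outwards. *)
Lemma tridiag_window_sol d al be X c :
  (forall k, k <= b -> d k = 1 + q ^+ 2 /\ be k = q) ->
  (forall k, b + m.+1%:Z <= k -> d k = 1 + q ^+ 2 /\ al k = q) ->
  (forall k, k < b -> al k = q) -> (forall k, b + m.+1%:Z < k -> be k = q) ->
  tmx d al be *m X = 1%:M ->
  tridiag d al be (window_sol X c) = lc c.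
Proof.
move=> dl dr all ber TX; apply: eq_lincomb => [|i|k kn]; first exact: site_inj.
  rewrite /window_sol -trimx_mul; last 2 first.
  - by have [] := dl b (lexx _).
  - by have [] := dr _ (lexx (b + m.+1%:Z)).
  under eq_bigr do rewrite mulr_sumr; rewrite exchange_big /=.
  transitivity (\sum_j c j * (i == j)%:R).
    apply: eq_bigr => j _; have /matrixP/(_ i j) := TX; rewrite !mxE => <-.
    by rewrite mulr_sumr; apply: eq_bigr => l _; rewrite mulrCA.
  rewrite (bigD1 i) //= eqxx mulr1 big1 ?addr0 // => j ji.
  by rewrite eq_sym (negbTE ji) mulr0.
have kout := site_out kn.
apply: tridiag_out => //.
- by case: kout => [/ltW /dl[]|/ltW /dr[]].
- by case: kout => [/all //|/ltW /dr[]].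
- by case: kout => [/ltW /dl[]|/ber].
Qed.

(** Reduces identities between corrected matrices to pointwise identities between tridiagonal
    operators. *)
Lemma trimx_mul_sol d al be X i j : be b = q -> al (b + m.+1%:Z) = q ->
  (tmx d al be *m X) i j =
  tridiag d al be (window_sol X (fun h => (h == j)%:R)) (pos i).
Proof.
move=> beb alb; rewrite mxE /window_sol -trimx_mul //.
apply: eq_bigr => h _; congr (_ * _); rewrite (bigD1 j) //= eqxx mul1r.
by rewrite big1 ?addr0 // => h' h'j; rewrite (negbTE h'j) mul0r.
Qed.

Lemma lincomb0 : lc (fun=> 0) = 0.
Proof. by apply/funext => k; rewrite /lincomb big1 // => i _; rewrite mul0r. Qed.
End Window.

(** * The Schroedinger operator *)

Section Schroedinger.
Variables (R : realType) (v : int -> R) (z : R[i]) (b : int) (m : nat).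
Hypothesis z_upper : 0 < complex.Im z.
Hypothesis v_window : forall k, k <= b \/ b + m.+1%:Z <= k -> v k = 0.
Local Notation N := m.+2.
Local Notation pos := (@site b m).
Local Notation q := (lambda_tilde z).
Local Notation l := (lambda v z).
Local Notation lc := (lincomb (R := R) pos).
Local Notation tmx := (trimx b m q).
Local Notation sol := (window_sol b q).
Local Notation Lm := (shiftL - Lambda v z).
Local Notation Rm := (shiftR - Lambda v z).
Local Notation d := (fun k => 1 + l k ^+ 2).
Implicit Types (f : seqZ R) (c : 'I_N -> R[i]) (k : int).

Lemma lambdaP k : [/\ l k != 0, `|l k| < 1 & l k + (l k)^-1 = z - (v k)%:C].
Proof. by apply: joukowskiP; rewrite raddfB /= subr0. Qed.

(** The two end sites are included, as the corner corrections require. *)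
Lemma lambda_out k : k <= b \/ b + m.+1%:Z <= k -> l k = q.
Proof. by move=> /v_window vk; rewrite /lambda vk subr0. Qed.

Lemma omega_out k : (forall i, k != pos i) \/ k = b + m.+1%:Z -> omega v z k = 0.
Proof.
move=> kn; suff kout : k < b \/ b + m.+1%:Z <= k.
  rewrite /omega !lambda_out ?subrr //; first by case: kout => kb; [left|right]; lia.
  by case: kout => kb; [left|right]; lia.
by case: kn => [/site_out[]|->]; [left|right; exact: ltW|right].
Qed.

Let q0 : q != 0. Proof. by have [] := joukowskiP z_upper. Qed.
Let q1 : `|q| < 1. Proof. by have [] := joukowskiP z_upper. Qed.
Let qz : q + q^-1 = z. Proof. by have [] := joukowskiP z_upper. Qed.

Lemma one_sub_sqr_neq0 : 1 - q ^+ 2 != 0.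
Proof.
rewrite subr_eq0; apply/negP => /eqP e; have := exprn_ilt1 2 (normr_ge0 q) q1.
by rewrite -normrX -e normr1 ltxx.
Qed.

(* The corrected window matrices of [(L - Lambda)(R - Lambda)],
   [(R - Lambda)(L - Lambda)], [- q (H0 - z)] and [- Lambda (H - z)]. *)
Definition mxLR := tmx d (fun k => l (k + 1)) l.
Definition mxRL := tmx d l (fun k => l (k - 1)).
Definition mxH0 := tmx (fun=> 1 + q ^+ 2) (fun=> q) (fun=> q).
Definition mxH := tmx d l l.

Lemma det_mxLR : \det mxLR = 1 - q ^+ 2.
Proof. by apply: det_trimx_LR; rewrite lambda_out //; [left|right]. Qed.

Lemma det_mxRL : \det mxRL = 1 - q ^+ 2.
Proof. by apply: det_trimx_RL; rewrite lambda_out //; [left|right]. Qed.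

Lemma det_mxH0 : \det mxH0 = 1 - q ^+ 2.
Proof. exact: (@det_trimx_LR _ b m q (fun=> q)). Qed.

Lemma mul_invmx_det (A : 'M[R[i]]_N) : \det A = 1 - q ^+ 2 ->
  A *m invmx A = 1%:M /\ \det (invmx A) = (1 - q ^+ 2)^-1.
Proof.
move=> dA; have Au : A \in unitmx by rewrite unitmxE dA unitfE one_sub_sqr_neq0.
by rewrite mulmxV // det_inv dA.
Qed.

Local Notation X := (invmx mxLR).
Local Notation Y := (invmx mxRL).
Local Notation W := (invmx mxH0).

Lemma ell2_Rm f : ell2 f -> ell2 (Rm f).
Proof.
move=> f2; apply: ell2B; first exact: ell2_shiftR.
by apply: ell2_diag => // n; have [_ /ltW] := lambdaP n.
Qed.

Lemma ell2_Lm f : ell2 f -> ell2 (Lm f).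
Proof.
move=> f2; apply: ell2B; first exact: ell2_shiftL.
by apply: ell2_diag => // n; have [_ /ltW] := lambdaP n.
Qed.

Lemma Lm_injective : ell2_injective Lm.
Proof. by apply: shiftL_diag_injective => n; have [_ /ltW] := lambdaP n. Qed.

Lemma Rm_injective : ell2_injective Rm.
Proof. by apply: shiftR_diag_injective => n; have [_ /ltW] := lambdaP n. Qed.

Lemma opinv_Lm_Rm f : ell2 f -> opinv Rm (opinv Lm (Lm (Rm f))) = f.
Proof.
move=> f2; rewrite (opinvK Lm_injective (ell2_Rm f2)).
exact: opinvK Rm_injective f2.
Qed.

Lemma opinv_Rm_Lm f : ell2 f -> opinv Lm (opinv Rm (Rm (Lm f))) = f.
Proof.
move=> f2; rewrite (opinvK Rm_injective (ell2_Lm f2)).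
exact: opinvK Lm_injective f2.
Qed.

Lemma Lm_Rm f : Lm (Rm f) = tridiag d (fun k => l (k + 1)) l f.
Proof.
apply/funext => k.
rewrite -[LHS]/((f (k + 1 - 1) - l (k + 1) * f (k + 1)) - l k * (f (k - 1) - l k * f k)).
by rewrite addrK /tridiag; ring.
Qed.

Lemma Rm_Lm f : Rm (Lm f) = tridiag d l (fun k => l (k - 1)) f.
Proof.
apply/funext => k.
rewrite -[LHS]/((f (k - 1 + 1) - l (k - 1) * f (k - 1)) - l k * (f (k + 1) - l k * f k)).
by rewrite subrK /tridiag; ring.
Qed.

Lemma Lm_Rm_sol c : Lm (Rm (sol X c)) = lc c.
Proof.
have [TX _] := mul_invmx_det det_mxLR.
rewrite -(tridiag_window_sol c _ _ _ _ TX) ?Lm_Rm // => k kb.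
- by rewrite !lambda_out //; left.
- by rewrite !lambda_out //; right; lia.
- by rewrite !lambda_out //; left; lia.
- by rewrite !lambda_out //; right; lia.
Qed.

Lemma Rm_Lm_sol c : Rm (Lm (sol Y c)) = lc c.
Proof.
have [TY _] := mul_invmx_det det_mxRL.
rewrite -(tridiag_window_sol c _ _ _ _ TY) ?Rm_Lm // => k kb.
- by rewrite !lambda_out //; left; lia.
- by rewrite !lambda_out //; right; lia.
- by rewrite !lambda_out //; left; lia.
- by rewrite !lambda_out //; right; lia.
Qed.

(** The solution with geometric tails is square-summable, hence it is the one that [opinv]
    selects. *)
Lemma opinv_Lm_Rm_lincomb c : opinv Rm (opinv Lm (lc c)) = sol X c.
Proof. by rewrite -Lm_Rm_sol opinv_Lm_Rm //; exact: (ell2_geoext _ _ q0 q1). Qed.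

Lemma opinv_Rm_Lm_lincomb c : opinv Lm (opinv Rm (lc c)) = sol Y c.
Proof. by rewrite -Rm_Lm_sol opinv_Rm_Lm //; exact: (ell2_geoext _ _ q0 q1). Qed.

(** The factor [- q] appears because [mxH0] represents [- q (H0 - z)]. *)
Lemma opinv_H0_lincomb c :
  opinv (H0 - diag (fun=> z)) (lc c) = fun k => - q * sol W c k.
Proof.
have [TX _] := mul_invmx_det det_mxH0.
have s2 : ell2 (fun k => - q * sol W c k) by apply: ell2Z; exact: (ell2_geoext _ _ q0 q1).
rewrite -[RHS](opinvK (H0_injective q0 (ltW q1) qz) s2); congr opinv.
rewrite -(tridiag_window_sol c _ _ _ _ TX) //.
apply/funext => k; rewrite /tridiag; set s := sol W c.
rewrite -[RHS]/(- q * s (k + 1) + - q * s (k - 1) - z * (- q * s k)).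
have -> : z * (- q * s k) = (q + q^-1) * (- q * s k) by rewrite qz.
by field; exact: q0.
Qed.

(** * Determinants of the finite rank operators *)

Let OmL : opZ R := Omega v z \o shiftL.
Let A1 : opZ R := OmL \o (opinv Rm \o opinv Lm).
Let A2 : opZ R := OmL \o (opinv Lm \o opinv Rm).

Lemma OmL_out f k : (forall i, k != pos i) -> OmL f k = 0.
Proof.
by move=> kn; rewrite /OmL /= /Omega /diag omega_out ?mul0r //; left.
Qed.

(** The first part is the linearity that [det2_rows] asks for; the second gives the matrix
    entries. *)
Lemma compress_OmL_sol (B : opZ R) T : (forall c, B (lc c) = sol T c) ->
  (forall c i, (OmL \o B) (lc c) (pos i) =
    \sum_j c j * (OmL \o B) (delta R (pos j)) (pos i)) /\
  forall i j, compress pos (OmL \o B) i j =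
    omega v z (pos i) * sol T (fun h => (h == j)%:R) (pos i + 1).
Proof.
move=> BT; split=> [c i|i j].
  rewrite /= BT /OmL /= /Omega /diag /shiftL window_solE mulr_sumr.
  apply: eq_bigr => j _.
  by rewrite (delta_lincomb R (@site_inj b m)) BT mulrCA.
by rewrite mxE /mx_elt (delta_lincomb R (@site_inj b m)) /= BT.
Qed.

(* The corrected window matrix of [- (H - z) Lambda]. *)
Definition mxHt := tmx d (fun k => l (k + 1)) (fun k => l (k - 1)).

Lemma tr_mxH : mxH^T = mxHt.
Proof.
apply/matrixP => i j; rewrite !mxE eq_sym.
rewrite [X in _ - X - _](_ : _ = (i == j.+1 :> nat)%:R * l (pos i - 1)); last first.
  rewrite eq_sym; case: eqP => [ij|]; rewrite ?mul0r // !mul1r /site ij.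
  by congr (l _); lia.
rewrite [X in _ - _ - X](_ : _ = (i.+1 == j :> nat)%:R * l (pos i + 1)); last first.
  rewrite eq_sym; case: eqP => [ij|]; rewrite ?mul0r // !mul1r /site -ij.
  by congr (l _); lia.
rewrite addrAC; congr (_ - _ - _).
by case: eqP => [->|] //; rewrite !mul0r.
Qed.

(** With [1 = mxLR X], adding [Omega L] turns the coefficient [l (k + 1)] into [l k], so the matrix
    is [mxH X]. *)
Lemma det_A1 : \det (1%:M + compress pos A1) = \det mxH / (1 - q ^+ 2).
Proof.
have [TX dX] := mul_invmx_det det_mxLR.
have [_ CA] := @compress_OmL_sol (opinv Rm \o opinv Lm) _ opinv_Lm_Rm_lincomb.
rewrite -dX -det_mulmx -TX; congr (\det _); apply/matrixP => i j.
rewrite [LHS]mxE CA !trimx_mul_sol ?lambda_out //; try lia.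
by rewrite /tridiag /omega; ring.
Qed.

(** With [1 = mxRL Y], subtracting [Omega L] turns the coefficient [l k] of [f (k + 1)] into
    [l (k + 1)]; the matrix is [mxHt Y], and [mxHt] is the transpose of [mxH]. *)
Lemma det_A2 : \det (1%:M + compress pos (- A2)) = \det mxH / (1 - q ^+ 2).
Proof.
have [TX dX] := mul_invmx_det det_mxRL.
have [_ CA] := @compress_OmL_sol (opinv Lm \o opinv Rm) _ opinv_Rm_Lm_lincomb.
have -> : compress pos (- A2) = - compress pos A2 by apply/matrixP => i j; rewrite !mxE.
rewrite -(det_tr mxH) tr_mxH -dX -det_mulmx -TX; congr (\det _); apply/matrixP => i j.
rewrite [LHS]mxE [X in _ + X]mxE CA !trimx_mul_sol ?lambda_out //; try lia.
by rewrite /tridiag /omega; ring.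
Qed.

Let A0 : opZ R := opinv (H0 - diag (fun=> z)) \o (H v - H0).

Lemma H_sub_H0 f : (H v - H0) f = diag (fun k => (v k)%:C) f.
Proof. by apply/funext => k; rewrite -[LHS]/(H0 f k + diag _ f k - H0 f k) addrC addKr. Qed.

Lemma A0_cols k k' : (forall i, k != pos i) -> mx_elt A0 k' k = 0.
Proof.
move=> kn; have vk : v k = 0.
  by apply: v_window; case: (site_out kn) => /ltW; [left|right].
rewrite /mx_elt /A0 /= H_sub_H0.
(* Zero is written as a combination over the window, so that the formula for the inverse applies to
   it. *)
have -> : diag (fun k => (v k)%:C) (delta R k) = lc (fun=> 0).
  rewrite lincomb0; apply/funext => h; rewrite /diag /delta; case: eqP => [->|_].
    by rewrite vk mul0r.
  by rewrite mulr0.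
rewrite opinv_H0_lincomb /window_sol /geoext.
by case: (k' - b) => h; rewrite big1 ?mulr0 // => j _; rewrite mul0r.
Qed.

Lemma compress_A0 : compress pos A0 =
  (- q *: W) *m diag_mx (\row_i (v (pos i))%:C).
Proof.
apply/matrixP => i j; rewrite mul_mx_diag !mxE /mx_elt /A0 /= H_sub_H0.
have -> : diag (fun k => (v k)%:C) (delta R (pos j)) =
    lc (fun i => (v (pos j))%:C * (i == j)%:R).
  apply: eq_lincomb => [|h|k kn]; first exact: site_inj.
    rewrite /diag /delta (inj_eq (@site_inj b m)).
    by case: eqP => [->|]; rewrite ?mulr0.
  by rewrite /diag /delta (negbTE (kn j)) mulr0.
rewrite opinv_H0_lincomb window_solE -mulrA; congr (_ * _).
rewrite (bigD1 j) //= eqxx mulr1 window_sol_site mulrC.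
by rewrite big1 ?addr0 // => h hj; rewrite (negbTE hj) mulr0 mul0r.
Qed.

Lemma det_A0 : \det (1%:M + compress pos A0) =
  \prod_i (q / l (pos i)) * (\det mxH / (1 - q ^+ 2)).
Proof.
have [TX dW] := mul_invmx_det det_mxH0.
rewrite compress_A0; set G := _ *: _; set V := diag_mx _.
have G0 : \det G != 0.
  by rewrite detZ dW mulf_neq0 ?expf_neq0 ?oppr_eq0 ?invr_eq0 ?one_sub_sqr_neq0.
(* Since [G] is invertible, this follows from [(1 + G V) G = G (1 + V G)]. *)
have -> : \det (1%:M + G *m V) = \det (1%:M + V *m G).
  apply: (mulIf G0); rewrite -det_mulmx [RHS]mulrC -det_mulmx.
  by rewrite mulmxDl mulmxDr mul1mx mulmx1 mulmxA.
(* Window form of [- Lambda (H - z) = (Lambda / q) (- q (H0 - z) - q V)], multiplied by [W] on the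
   right. *)
have MW : mxH *m W = diag_mx (\row_i (l (pos i) / q)) *m (1%:M + V *m G).
  apply/matrixP => i j; have [l0 _ lz] := lambdaP (pos i).
  transitivity (l (pos i) / q *
      ((mxH0 *m W) i j + (v (pos i))%:C * (- q * W i j))); last first.
    by rewrite TX /V /G !mul_diag_mx !mxE.
  (* Subtract [l + 1/l = z - v] from [q + 1/q = z]. *)
  have vE : (v (pos i))%:C = q + q^-1 - (l (pos i) + (l (pos i))^-1).
    by rewrite qz lz opprB addrC subrK.
  rewrite -(window_sol_site b q W i j).
  rewrite (@trimx_mul_sol R b m q (fun=> 1 + q ^+ 2) (fun=> q) (fun=> q)) //.
  rewrite trimx_mul_sol; last 2 first.
  - by apply: lambda_out; left.
  - by apply: lambda_out; right.
  by rewrite vE /tridiag; field; rewrite l0 q0.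
rewrite -dW -det_mulmx MW det_mulmx det_diag mulrA -big_split /=.
rewrite big1 ?mul1r // => i _; have [l0 _ _] := lambdaP (pos i).
by rewrite mxE mulrA divfK // divff.
Qed.

(** * Assembly of the formula *)

Lemma sum_sites (F : int -> R[i]) (idx : R[i]) (op : Monoid.com_law idx) :
  \big[op/idx]_(k <- [fset pos i | i in 'I_N]%fset) F k = \big[op/idx]_i F (pos i).
Proof.
by rewrite big_imfset /= ?big_enum // => i j _ _; exact: site_inj.
Qed.

Lemma det_ratio_window :
  let L : opZ R := shiftL in
  let Rt : opZ R := shiftR in
  let Om := Omega v z in
  let Linv := opinv (L - Lambda v z) in
  let Rinv := opinv (Rt - Lambda v z) in
  exists s : R[i],
    s ^+ 2 = det2 (id + (Om \o L \o Rinv \o Linv))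
             * det2 (id - (Om \o L \o Linv \o Rinv)) /\
    fredholm_det (id + (opinv (H0 - diag (fun=> z)) \o (H v - H0)))
    = (\big[*%R/1]_(j \in [set: int]) (lambda_tilde z / lambda v z j))
      * cexp (2^-1 * optrace (Om \o L \o Linv \o Rinv \o
                                ((Rt \o Om) + (Om \o L)) \o Rinv \o Linv))
      * s.
Proof.
move=> L Rt Om Linv Rinv; set B := (X in optrace X).
set S := [fset pos i | i in 'I_N]%fset.
have SP k : k \notin S -> forall i, k != pos i.
  by move=> kS i; apply: contraNneq kS => ->; apply/imfsetP; exists i.
have [lin1 C1] := @compress_OmL_sol (opinv Rm \o opinv Lm) _ opinv_Lm_Rm_lincomb.
have [lin2 C2] := @compress_OmL_sol (opinv Lm \o opinv Rm) _ opinv_Rm_Lm_lincomb.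
have detE1 : det2 (id + A1) = \det mxH / (1 - q ^+ 2) * cexp (- \tr (compress pos A1)).
  rewrite (det2_rows (@site_inj b m)) ?det_A1 // => f k kn.
  exact: OmL_out.
have detE2 : det2 (id + - A2) =
    \det mxH / (1 - q ^+ 2) * cexp (- \tr (compress pos (- A2))).
  rewrite (det2_rows (@site_inj b m)) ?det_A2 // => [f k kn|c i].
    by rewrite -[LHS]/(- OmL (opinv Lm (opinv Rm f)) k) OmL_out ?oppr0.
  rewrite -[LHS]/(- (OmL \o (opinv Lm \o opinv Rm)) (lc c) (pos i)) lin2 -sumrN.
  by apply: eq_bigr => j _; rewrite -mulrN.
have trB : optrace B = \tr (compress pos A1) - \tr (compress pos A2).
  rewrite /optrace (usum_fset (A := S)); last first.
    by move=> k /SP kn; apply: OmL_out.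
  rewrite sum_sites -sumrB; apply: eq_bigr => i _.
  rewrite C1 C2 /mx_elt (delta_lincomb R (@site_inj b m)).
  set c := fun h => _; set x := sol X c; set y := sol Y c.
  have xE : Rinv (Linv (lc c)) = x by exact: opinv_Lm_Rm_lincomb.
  have x2 : ell2 x := ell2_geoext _ _ q0 q1.
  have y2 : ell2 y := ell2_geoext _ _ q0 q1.
  (* [(R - Lambda)(L - Lambda) y] and [(L - Lambda)(R - Lambda) x] both equal [lc c], so
     [(R Omega + Omega L) x] is [(R - Lambda)(L - Lambda)] applied to [x - y], which the two
     inverses undo. *)
  have -> : B (lc c) = OmL (x - y).
    rewrite /B /= xE; congr OmL.
    have xy2 : ell2 (x - y) by exact: ell2B.
    rewrite -[RHS](opinv_Rm_Lm xy2); congr (opinv Lm (opinv Rm _)).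
    have /(congr1 (fun f : seqZ R => f _)) yE := Rm_Lm_sol c.
    have /(congr1 (fun f : seqZ R => f _)) xE' := Lm_Rm_sol c.
    apply/funext => k; move: (yE k) (xE' k); rewrite !Rm_Lm Lm_Rm.
    move=> {}yE {}xE'.
    transitivity (tridiag d l (fun k => l (k - 1)) x k -
        tridiag d l (fun k => l (k - 1)) y k); last first.
      rewrite /tridiag -[(x - y) k]/(x k - y k).
      by rewrite -[(x - y) (k + 1)]/(x _ - y _) -[(x - y) (k - 1)]/(x _ - y _); ring.
    rewrite yE -xE' -/x /tridiag.
    rewrite -[LHS]/(omega v z (k - 1) * x (k - 1) + omega v z k * x (k + 1)).
    by rewrite /omega subrK; ring.
  by rewrite /OmL /= /Omega /diag /shiftL mulrBr.
have DE : fredholm_det (id + A0) =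
    \big[*%R/1]_(j \in [set: int]) (q / l j) * (\det mxH / (1 - q ^+ 2)).
  rewrite (fredholm_det_cols (@site_inj b m)); last first.
    by move=> k k' kn; exact: A0_cols.
  rewrite det_A0 (@fsbigTE _ _ _ _ S) ?sum_sites // => k /SP /site_out kn.
  by rewrite lambda_out ?divff //; case: kn => /ltW; [left|right].
set D := \det mxH / (1 - q ^+ 2) in detE1 detE2 DE.
(* The two regularized determinants are [D e^(- tr A1)] and [D e^(tr A2)], with product
   [D^2 e^(- tr B)]; this root also cancels the exponential factor of the formula. *)
exists (D * cexp (- (2^-1 * optrace B))); split.
  transitivity (det2 (id + A1) * det2 (id + - A2)); last by [].
  rewrite detE1 detE2 [RHS]mulrACA exprMn -expr2; congr (_ * _).
  rewrite expr2 -!cexpD trB.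
  have -> : compress pos (- A2) = - compress pos A2 by apply/matrixP => i j; rewrite !mxE.
  by rewrite raddfN; congr cexp; field.
transitivity (fredholm_det (id + A0)); first by [].
rewrite DE -mulrA; congr (_ * _).
by rewrite mulrCA -cexpD subrr cexp0 mulr1.
Qed.
End Schroedinger.

Lemma finite_window (R : realType) (v : int -> R) :
  finite_set [set j | v j != 0] ->
  exists (b : int) (m : nat), forall k, k <= b \/ b + m.+1%:Z <= k -> v k = 0.
Proof.
move=> /finite_fsetP[S vS]; pose M := (\max_(j <- S) absz j)%N.
(* The window runs from [- (M + 1)] to [M + 1], so [v] vanishes at both end sites. *)
exists (- M.+1%:Z), M.*2.+1 => k kout; apply/eqP/negPn/negP => vk.
have kS : k \in S by have : [set j | v j != 0] k by []; rewrite vS.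
have kM : (absz k <= M)%N by exact: leq_bigmax_seq.
by move: kM kout; clearbody M; clear; lia.
Qed.

Unset Implicit Arguments.

Theorem lemma1p7 (R : realType) (v : int -> R) (z : R[i])
    (v_fin : finite_set [set j | v j != 0]) (z_upper : 0 < complex.Im z) :
  let L : opZ R := shiftL in
  let Rt : opZ R := shiftR in
  let Om := Omega v z in
  let Linv := opinv (L - Lambda v z) in
  let Rinv := opinv (Rt - Lambda v z) in
  exists s : R[i],
    s ^+ 2 = det2 (id + (Om \o L \o Rinv \o Linv))
             * det2 (id - (Om \o L \o Linv \o Rinv)) /\
    fredholm_det (id + (opinv (H0 - diag (fun=> z)) \o (H v - H0)))
    = (\big[*%R/1]_(j \in [set: int]) (lambda_tilde z / lambda v z j))
      * cexp (2^-1 * optrace (Om \o L \o Linv \o Rinv \o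
                                ((Rt \o Om) + (Om \o L)) \o Rinv \o Linv))
      * s.
Proof.
have [b [m v_window]] := finite_window v_fin.
exact: det_ratio_window z_upper v_window.
Qed.
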